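(* Let $d>m\ge1$ be integers, $\mathbf{j}=(j_i)_{i=1}^{m+1}\in\mathcal{P}_m(d)$, $\mathbf{r}=(r_i)_{i=1}^{m+1}$ with $0\le r_1<\dots<r_{m+1}\le1$, and $\delta\in(0,1)$. Let $\eta\in[\delta^{r_1},1]$ and $\tau,\varepsilon,\varepsilon'>0$. Let $(\Theta,\sigma)$ be a probability space. For each $Q\in\mathcal{D}_\eta$, consider a measurable map $\Theta\to\mathcal{F}_{\mathbf{j}}$, $\theta\mapsto\mathcal{V}_{Q,\theta}=(V_{Q,\theta,i})_{i=1}^{m+1}$. Assume that for every $Q\in\mathcal{D}_\eta$ and every $i\in\{1,\dots,m\}$, the distribution of $V_{Q,\theta,i}$ as $\theta\sim\sigma$ satisfies $(\mathrm{S}^-)$ with parameters $(\delta^{r_{i+1}},\varepsilon,\tau)$. Let $\nu$ be a Borel measure on $B^{\mathbb{R}^d}_1$ of mass at most $1$, and for $i=1,\dots,m+1$ let $t_i>0$ be such that $\nu(B^{\mathbb{R}^d}_{\delta^{r_i}}+v)\le t_i$ for all $v\in\mathbb{R}^d$. There exist an absolute constant $c>0$ and a constant $c'=c'(d,\varepsilon)>0$ such that if $\varepsilon'\le c\,\varepsilon$ and $\delta^{r_2}\le c'$, then there exists $\mathcal{E}\subseteq\Theta$ with $\sigma(\mathcal{E})\le\delta^{r_2\varepsilon'}$ such that for all $\theta\in\Theta\setminus\mathcal{E}$ there is a set $F_\theta\subseteq\mathbb{R}^d$ with $\nu(F_\theta)\le\delta^{r_2\varepsilon'}$ and such that for all $Q\in\mathcal{D}_\eta$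 and $v\in\mathbb{R}^d$, $$\nu_{|Q\setminus F_\theta}\bigl(B^{\mathcal{V}_{Q,\theta}}_{\delta^{\mathbf{r}}}+v\bigr)\le\delta^{-(\tau+\varepsilon)\sum_{i=2}^{m+1}r_i}\prod_{i=1}^{m+1}t_i^{j_i/d}.$$
   Context: $\mathbb{R}^d$ has its standard Euclidean structure; for a subspace $V$, $B^V_r$ is the open ball of radius $r$ in $V$ centered at $0$. $\mathcal{N}_\delta(A)$ is the smallest number of $\delta$-balls needed to cover $A$. $\pi_{\|V}$ is the orthogonal projector with kernel $V$ (i.e. onto $V^\perp$). $\mathrm{Gr}(\mathbb{R}^d)$ is the set of all linear subspaces of $\mathbb{R}^d$. For $\eta>0$, $\mathcal{D}_\eta$ is the partition of $\mathbb{R}^d$ into translates by $2^{-k}\mathbb{Z}^d$ of the cell $[0,2^{-k})^d$, where $k\in\mathbb{Z}$ satisfies $2^{-k-1}<\eta\le2^{-k}$. $\mathcal{P}_m(d)$ is the set of $(j_i)_{i=1}^{m+1}$ of positive integers with $j_1+\dots+j_{m+1}=d$. For $\mathbf{j}\in\mathcal{P}_m(d)$, $\mathcal{F}_{\mathbf{j}}$ is the set of partial flags $\{0\}\subsetneq V_1\subsetneq\dots\subsetneq V_{m+1}=\mathbb{R}^d$ with $\dim V_i=j_1+\dots+j_i$ for all $i$. For $\mathcal{V}=(V_i)_i\in\mathcal{F}_{\mathbf{j}}$, $B^{\mathcal{V}}_{\delta^{\mathbf{r}}}=\sum_{i=1}^{m+1}B^{V_i}_{\delta^{r_i}}$ (Minkowski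 sum). Subcritical property $(\mathrm{S}^-)$: a probability measure $\sigma_0$ on $\mathrm{Gr}(\mathbb{R}^d)$ has $(\mathrm{S}^-)$ with parameters $(\delta_0,\varepsilon,\tau)$ if for every set $A\subseteq B^{\mathbb{R}^d}_1$, the set of $V\in\mathrm{Gr}(\mathbb{R}^d)$ for which there exists $A'\subseteq A$ with $\mathcal{N}_{\delta_0}(A')\ge\delta_0^{\varepsilon}\mathcal{N}_{\delta_0}(A)$ and $\mathcal{N}_{\delta_0}(\pi_{\|V}A')<\delta_0^{\tau}\,\mathcal{N}_{\delta_0}(A)^{\dim V^\perp/d}$ has $\sigma_0$-measure at most $\delta_0^{\varepsilon}$. *)

(* Defs.v *)
From HB Require Import structures.
From mathcomp Require Import all_boot all_order all_algebra.
From mathcomp Require Import all_classical all_reals all_analysis.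

Set Implicit Arguments.
Unset Strict Implicit.
Unset Printing Implicit Defensive.

Import Order.TTheory GRing.Theory Num.Theory.
Import numFieldNormedType.Exports.

Local Open Scope classical_set_scope.
Local Open Scope ring_scope.

Section Euclidean.
Context {R : realType} {d : nat}.
Implicit Types (x y : 'rV[R]_d) (V : {vspace 'rV[R]_d}) (A : set 'rV[R]_d).

Definition dot x y : R := \sum_(i < d) x 0 i * y 0 i.

(* The norm [`|x|] that the library puts on ['rV[R]_d] is the sup norm. *)
Definition enorm x : R := Num.sqrt (dot x x).

Definition vball V (r : R) : set 'rV[R]_d := [set x | x \in V /\ enorm x < r].

Definition eball (r : R) : set 'rV[R]_d := vball fullv r.

Definition translate A x : set 'rV[R]_d := [set a + x | a in A].

Definition covered_by (delta : R) A (n : nat) : Prop :=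
  exists c : 'I_n -> 'rV[R]_d,
    A `<=` [set x | exists i, translate (eball delta) (c i) x].

Definition covering_number (delta : R) A : \bar R :=
  ereal_inf [set (n%:R)%:E | n in covered_by delta A].

Definition basis_mx V : 'M[R]_(\dim V, d) := \matrix_(i < \dim V) (vbasis V)`_i.

Definition orthv V : {vspace 'rV[R]_d} :=
  lker (linfun (mulmxr (basis_mx V)^T)).

(* The projector onto [orthv V] along [V]. *)
Definition proj_along V : 'End('rV[R]_d) := daddv_pi (orthv V) V.

Lemma dotE x y : dot x y = (x *m y^T) 0 0.
Proof. by rewrite mxE; apply: eq_bigr => i _; rewrite mxE. Qed.

Lemma dot_eq0 x : dot x x = 0 -> x = 0.
Proof.
move=> /eqP; rewrite psumr_eq0; last by move=> i _; rewrite -expr2 sqr_ge0.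
move=> /allP x0; apply/rowP => i; rewrite mxE.
by have := x0 i (mem_index_enum i); rewrite mulf_eq0 orbb => /eqP.
Qed.

Lemma memv_orthv V x :
  x \in orthv V <-> (forall v, v \in V -> dot x v = 0).
Proof.
rewrite memv_ker lfunE /=; split.
- move=> /eqP x0 v /coord_vbasis ->; rewrite dotE linear_sum/= mulmx_sumr.
  rewrite summxE big1// => i _; rewrite linearZ/= -scalemxAr mxE.
  suff -> : (x *m ((vbasis V)`_i)^T) 0 0 = 0 by rewrite mulr0.
  have /rowP/(_ i) := x0; rewrite !mxE => xi0; rewrite -[RHS]xi0.
  by apply: eq_bigr => k _; rewrite !mxE.
- move=> xV; apply/eqP/rowP => i; rewrite !mxE.
  rewrite -[RHS](xV (vbasis V)`_i); last by rewrite vbasis_mem// mem_nth// size_tuple.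
  by apply: eq_bigr => k _; rewrite !mxE.
Qed.

Lemma capv_orthv V : (orthv V :&: V = 0)%VS.
Proof.
apply/eqP; rewrite -subv0; apply/subvP => x; rewrite memv_cap => /andP[xo xV].
by rewrite memv0; apply/eqP/dot_eq0; move/memv_orthv: xo; apply.
Qed.

Lemma addv_orthv V : (orthv V + V = fullv)%VS.
Proof.
apply/eqP; rewrite eqEdim subvf/= dimv_disjoint_sum ?capv_orthv//.
have := limg_ker_dim (linfun (@mulmxr _ 1 _ _ (basis_mx V)^T)) fullv.
rewrite capfv -/(orthv V) => <-; rewrite leq_add2l.
by rewrite (leq_trans (dimvS (subvf _)))// dimvf /dim/= mul1n.
Qed.

Lemma proj_alongP V x : proj_along V x \in orthv V /\ x - proj_along V x \in V.
Proof.
split; first exact: memv_pi.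
have xf : x \in (orthv V + V)%VS by rewrite addv_orthv memvf.
rewrite -{1}(daddv_pi_add (capv_orthv V) xf) addrC addKr.
exact: memv_pi.
Qed.

End Euclidean.

HB.instance Definition _ (R : realType) (d : nat) :=
  isPointed.Build {vspace 'rV[R]_d} 0%VS.

(* The linear subspaces of R^d, with the usual topology: the one induced by the
   embedding into matrices that sends V to the orthogonal projector with kernel
   V (equivalently, to the complementary projector, with image V). *)
Definition grass (R : realType) (d : nat) : Type :=
  initial_topology
    (fun V : {vspace 'rV[R]_d} => lin1_mx (proj_along V) : 'M[R]_d).

HB.instance Definition _ R d := Topological.on (grass R d).
HB.instance Definition _ R d :=
  Pointed.copy (grass R d) {vspace 'rV[R]_d}.

Notation borel_rV R d := (g_sigma_algebraType (@open 'rV[R]_d)).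
Notation Gr R d := (g_sigma_algebraType (@open (grass R d))).

Section Flags.
Context {R : realType} {d m : nat}.

Definition composition (j : 'I_m.+1 -> nat) : Prop :=
  (forall i, 0 < j i)%N /\ (\sum_(i < m.+1) j i)%N = d.

(* Indices are shifted by one: [tnth V i] is the subspace [V_(i+1)]. *)
Definition flag (j : 'I_m.+1 -> nat) (V : m.+1.-tuple {vspace 'rV[R]_d}) : Prop :=
  [/\ tnth V ord0 != 0%VS,
      tnth V ord_max = fullv,
      forall i k : 'I_m.+1, (i < k)%N ->
        (tnth V i <= tnth V k)%VS /\ tnth V i != tnth V k
    & forall i : 'I_m.+1, \dim (tnth V i) = (\sum_(k < m.+1 | k <= i) j k)%N].

Definition flag_ball (V : m.+1.-tuple {vspace 'rV[R]_d}) (delta : R)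
    (r : 'I_m.+1 -> R) : set 'rV[R]_d :=
  [set x | exists2 u : 'I_m.+1 -> 'rV[R]_d,
     forall i, vball (tnth V i) (delta `^ r i) (u i) & x = \sum_(i < m.+1) u i].

End Flags.

Section FlagComponent.
Context {R : realType} {d m : nat}.
Context {disp : measure_display} {T : measurableType disp}.

(* The tuple type carries the product of the Borel sigma-algebras. *)
Definition flag_comp (V : {mfun T >-> m.+1.-tuple (Gr R d)}) (i : 'I_m.+1)
  : T -> Gr R d := fun t => tnth (V t) i.

Lemma measurable_flag_comp V i : measurable_fun setT (flag_comp V i).
Proof. exact: (measurable_fun_tnthP V).1 (measurable_funPT V) i. Qed.

HB.instance Definition _ V i :=
  isMeasurableFun.Build _ _ _ _ (flag_comp V i) (measurable_flag_comp V i).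

End FlagComponent.

Definition dyadic_cell {R : realType} {d : nat} (k : int) (z : 'I_d -> int) :
    set 'rV[R]_d :=
  [set x | forall i, (z i)%:~R * 2 ^ (- k) <= x 0 i < ((z i)%:~R + 1) * 2 ^ (- k)].

Definition dyadic {R : realType} (d : nat) (eta : R) : set (set 'rV[R]_d) :=
  [set Q | exists k : int, 2 ^ (- k - 1) < eta <= 2 ^ (- k) /\
     exists z : 'I_d -> int, Q = dyadic_cell k z].

Arguments dyadic {R} d eta.

Section Subcritical.
Context {R : realType} {d : nat}.
Local Open Scope ereal_scope.

Definition small_projection (delta0 eps tau : R) (A : set 'rV[R]_d) :
    set (Gr R d) :=
  [set V : {vspace 'rV[R]_d} | exists A' : set 'rV[R]_d,
     [/\ A' `<=` A,
         (delta0 `^ eps)%:E * covering_number delta0 A <= covering_number delta0 A'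
       & covering_number delta0 (proj_along V @` A') <
         (delta0 `^ tau)%:E *
         covering_number delta0 A `^ ((\dim (orthv V))%:R / d%:R)%R]].

(* As [A] is arbitrary, [small_projection] need not be Borel: its measure is
   understood as an outer measure. *)
Definition subcritical (sigma0 : probability (Gr R d) R) (delta0 eps tau : R)
    : Prop :=
  forall A : set 'rV[R]_d, A `<=` eball 1 ->
  exists E : set (Gr R d),
    [/\ measurable E, small_projection delta0 eps tau A `<=` E
      & sigma0 E <= (delta0 `^ eps)%:E].

End Subcritical.

(* Main.v *)
(* Cut the unit ball into nested dyadic cells of side comparable to
   delta ^ r_1 >= ... >= delta ^ r_(m+1), and write S < P when S is a cell of
   level i+1 inside the cell P of level i.  If S ranges over the cells inside P
   that have about a given mass, the subcritical property of V_i at scale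
   delta ^ r_(i+1) says that, outside a small proportion of these cells, each
   fibre of the projection along V_i meets at most
   delta ^ (- tau * r_(i+1)) * (number of cells) ^ (dim V_i / d) of them.
   Summing over the possible masses gives, with a_i = dim V_i / d,
     sum_(S < P, S good, S meets the flag box) nu(S) ^ a_i
       <= delta ^ (- (tau + eps) * r_(i+1)) * nu(P) ^ a_i,
   and the theorem follows by telescoping from level m+1 up to level 1, using
   nu(P) ^ a_i <= t_i ^ (j_i / d) * nu(P) ^ a_(i-1).  The bad cells form F_theta;
   the theta for which they are too heavy are discarded by Markov's inequality. *)

From HB Require Import structures.
From mathcomp Require Import all_boot all_order all_algebra.
From mathcomp Require Import all_classical all_reals all_analysis.
From mathcomp Require Import measurable_realfun zify lra ring.
Require Import Defs.

Set Implicit Arguments.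
Unset Strict Implicit.
Unset Printing Implicit Defensive.

Import Order.TTheory GRing.Theory Num.Theory.
Import numFieldNormedType.Exports.

Local Open Scope classical_set_scope.
Local Open Scope ring_scope.

(** * Grid cells *)

Definition gcell {R : realType} {d : nat} (h : R) (x : 'rV[R]_d) :
    {ffun 'I_d -> int} :=
  [ffun a => Num.floor (x 0 a / h)].

Lemma size_int_box (d n : nat) (w : {ffun 'I_d -> int})
    (s : seq {ffun 'I_d -> int}) :
  uniq s -> (forall u, u \in s -> forall a, `|u a - w a| <= n%:Z) ->
  (size s <= (2 * n + 1) ^ d)%N.
Proof.
move=> us sw.
pose f (u : {ffun 'I_d -> int}) : {ffun 'I_d -> 'I_(2 * n).+1} :=
  [ffun a => inord `|(u a - w a + n%:Z)%R|%N].
have finj : {in s &, injective f}.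
  move=> u v su sv /ffunP fuv; apply/ffunP => a.
  have /(congr1 val) := fuv a; rewrite !ffunE /=.
  have := sw u su a; have := sw v sv a => h1 h2.
  have E (z z' : int) : `|z - z'|%R <= n%:Z ->
    (`|(z - z' + n%:Z)%R| < (2 * n).+1)%N by lia.
  have I (z z' z'' : int) : `|z - z''|%R <= n%:Z -> `|z' - z''|%R <= n%:Z ->
    `|(z - z'' + n%:Z)%R|%N = `|(z' - z'' + n%:Z)%R|%N -> z = z' by lia.
  by rewrite !inordK; [exact: I|exact: E|exact: E].
have um : uniq (map f s) by rewrite map_inj_in_uniq.
rewrite -(size_map f) -(card_uniqP um).
apply: leq_trans (max_card _) _.
by rewrite card_ffun !card_ord addn1.
Qed.

Lemma gcell_dist {R : realType} (d : nat) (h : R) (x y : 'rV[R]_d) a :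
  0 < h -> gcell h x = gcell h y -> `|x 0 a - y 0 a| < h.
Proof.
move=> h0 /ffunP/(_ a); rewrite !ffunE => e.
have /andP[x1 x2] := floor_itv (x 0 a / h).
have /andP[y1 y2] := floor_itv (y 0 a / h).
rewrite e in x1 x2.
have : `|x 0 a / h - y 0 a / h| < 1.
  rewrite ltr_norml; apply/andP; split; move: x1 x2 y1 y2;
    rewrite intrD mulr1z; lra.
by rewrite -mulrBl normrM (gtr0_norm (x := h^-1)) ?invr_gt0// ltr_pdivrMr ?mul1r.
Qed.

Lemma gcell_near {R : realType} (d n : nat) (h : R) (x v : 'rV[R]_d) a :
  0 < h -> `|x 0 a - v 0 a| <= n%:R * h ->
  `|gcell h x a - gcell h v a| <= n.+1%:Z.
Proof.
move=> h0 xv; rewrite !ffunE.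
have /andP[x1 x2] := floor_itv (x 0 a / h).
have /andP[v1 v2] := floor_itv (v 0 a / h).
have : `|x 0 a / h - v 0 a / h| <= n%:R.
  by rewrite -mulrBl normrM (gtr0_norm (x := h^-1)) ?invr_gt0// ler_pdivrMr.
rewrite ler_norml => /andP[b1 b2].
set A := Num.floor _ in x1 x2 *; set B := Num.floor _ in v1 v2 *.
rewrite -(ler_int R) intr_norm intrB ler_norml.
rewrite !intrD !mulr1z in x2 v2.
rewrite -pmulrn -natr1.
by apply/andP; split; lra.
Qed.

Definition cell_count (d n : nat) : nat := ((2 * n.+1 + 1) ^ d)%N.

Lemma size_undup_gcell {R : realType} (d n : nat) (T : finType) (A : {set T})
    (f : T -> 'rV[R]_d) (h : R) (v : 'rV[R]_d) :
  0 < h -> (forall x, x \in A -> forall a, `|f x 0 a - v 0 a| <= n%:R * h) ->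
  (size (undup [seq gcell h (f x) | x in A]) <= cell_count d n)%N.
Proof.
move=> h0 Av; apply: (@size_int_box d n.+1 (gcell h v)) => [|u]; first exact: undup_uniq.
rewrite mem_undup => /mapP[x]; rewrite mem_enum => xA -> a.
by apply: gcell_near => //; exact: Av.
Qed.

Lemma card_gcell {R : realType} (d n : nat) (T : finType) (A : {set T})
    (f : T -> 'rV[R]_d) (h : R) (v : 'rV[R]_d) :
  0 < h -> {in A &, injective (gcell h \o f)} ->
  (forall x, x \in A -> forall a, `|f x 0 a - v 0 a| <= n%:R * h) ->
  (#|A| <= cell_count d n)%N.
Proof.
move=> h0 finj Av; apply: leq_trans (@size_undup_gcell R d n T A f h v h0 Av).
rewrite undup_id ?size_image//.
by apply/(@dinjectiveP _ _ _ (mem A)) => x y xA yA; exact: finj.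
Qed.

Lemma card_fibres (T : finType) (E : eqType) (A : {set T}) (g : T -> E) :
  #|A| = (\sum_(W <- undup [seq g x | x in A]) #|[set y in A | g y == W]|)%N.
Proof.
under eq_bigr => W _ do rewrite -sum1_card.
rewrite (exchange_big_dep (mem A)) /=; last first.
  by move=> W y _; rewrite inE => /andP[].
rewrite -sum1_card; apply: eq_bigr => y yA.
under eq_bigl => W do rewrite inE yA eq_sym /=.
by rewrite sum1_count count_uniq_mem ?undup_uniq// mem_undup map_f// mem_enum.
Qed.

Lemma card_le_fibres {R : realType} (T : finType) (E : eqType) (A : {set T})
    (g : T -> E) (M : R) :
  (forall x, x \in A -> #|[set y in A | g y == g x]|%:R <= M) ->
  #|A|%:R <= (size (undup [seq g x | x in A]))%:R * M.
Proof.
move=> AM; rewrite (card_fibres A g) natr_sum.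
rewrite -sum1_size natr_sum mulr_suml [leLHS]big_seq [leRHS]big_seq.
apply: ler_sum => W; rewrite mem_undup => /mapP[x]; rewrite mem_enum => xA ->.
by rewrite mul1r AM.
Qed.

Lemma card_ge_fibres {R : realType} (T : finType) (E : eqType) (A : {set T})
    (g : T -> E) (M : R) :
  (forall x, x \in A -> M <= #|[set y in A | g y == g x]|%:R) ->
  (size (undup [seq g x | x in A]))%:R * M <= #|A|%:R.
Proof.
move=> AM; rewrite (card_fibres A g) natr_sum.
rewrite -sum1_size natr_sum mulr_suml [leLHS]big_seq [leRHS]big_seq.
apply: ler_sum => W; rewrite mem_undup => /mapP[x]; rewrite mem_enum => xA ->.
by rewrite mul1r AM.
Qed.

(** * Projections and covering numbers *)

Lemma dot_ge0 {R : realType} d (x : 'rV[R]_d) : 0 <= dot x x.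
Proof. by apply: sumr_ge0 => i _; rewrite -expr2 sqr_ge0. Qed.

Lemma coord_le_enorm {R : realType} d (x : 'rV[R]_d) a : `|x 0 a| <= enorm x.
Proof.
rewrite -sqrtr_sqr ler_wsqrtr// /dot (bigD1 a)//= -expr2 lerDl.
by apply: sumr_ge0 => i _; rewrite -expr2 sqr_ge0.
Qed.

Lemma enorm_lt {R : realType} d (x : 'rV[R]_d) (e : R) :
  0 < e -> (forall a, `|x 0 a| < e / d%:R) -> enorm x < e.
Proof.
move=> e0 xe; case: d x xe => [|d] x xe.
  by rewrite /enorm /dot big_ord0 sqrtr0.
have xe2 a : x 0 a * x 0 a < (e / d.+1%:R) ^+ 2.
  by rewrite -expr2 -real_normK ?num_real// ltr_pXn2r ?nnegrE ?divr_ge0 ?ler0n// ltW.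
rewrite -(gtr0_norm e0) -sqrtr_sqr ltr_sqrt ?exprn_gt0//.
apply: (@lt_le_trans _ _ (\sum_(a < d.+1) (e / d.+1%:R) ^+ 2)).
  apply: ltr_sum => //.
  by apply/hasP; exists ord0; rewrite ?mem_index_enum.
rewrite sumr_const card_ord expr_div_n -[leRHS]mulr1 -mulrnAr ler_pM2l ?exprn_gt0//.
rewrite -(mulr_natl _ d.+1) expr2 invfM mulrA mulfV// mul1r.
by rewrite invf_le1// ler1n.
Qed.

Lemma dot_projD {R : realType} d (V : {vspace 'rV[R]_d}) (x : 'rV[R]_d) :
  dot x x = dot (proj_along V x) (proj_along V x)
          + dot (x - proj_along V x) (x - proj_along V x).
Proof.
have [po pV] := proj_alongP V x.
have pq : dot (proj_along V x) (x - proj_along V x) = 0.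
  by move/memv_orthv: po; apply.
set y := proj_along V x in pq *.
rewrite -[in LHS](subrK y x) (addrC _ y).
move: (x - y) pq => z pq.
have -> : dot (y + z) (y + z) = dot y y + dot y z + dot y z + dot z z.
  rewrite /dot -!big_split/=; apply: eq_bigr => i _; rewrite !mxE; ring.
by rewrite pq !addr0.
Qed.

Lemma enorm_proj_le {R : realType} d (V : {vspace 'rV[R]_d}) (x : 'rV[R]_d) :
  enorm (proj_along V x) <= enorm x.
Proof. by rewrite ler_wsqrtr// [leRHS](dot_projD V) lerDl dot_ge0. Qed.

Lemma proj_along_eq0 {R : realType} d (V : {vspace 'rV[R]_d}) (x : 'rV[R]_d) :
  x \in V -> proj_along V x = 0.
Proof.
move=> xV; have [po pV] := proj_alongP V x.
apply/dot_eq0; move/memv_orthv: po; apply.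
by rewrite -[proj_along V x](subKr x) memvB.
Qed.

Lemma dim_orthv {R : realType} d (V : {vspace 'rV[R]_d}) :
  (\dim (orthv V) + \dim V)%N = d.
Proof.
have := dimv_disjoint_sum (capv_orthv V).
by rewrite addv_orthv dimvf /dim /= mul1n => <-.
Qed.

Lemma mem_translate {R : realType} d (A : set 'rV[R]_d) (c x : 'rV[R]_d) :
  translate A c x <-> A (x - c).
Proof.
split=> [[a Aa <-]|Axc]; first by rewrite addrK.
by exists (x - c) => //; rewrite subrK.
Qed.

Lemma eballE {R : realType} d (e : R) (x : 'rV[R]_d) :
  eball e x <-> enorm x < e.
Proof. by split=> [[]|xe] //; split => //; rewrite memvf. Qed.

Lemma covering_number_le {R : realType} (d : nat) (T : finType) (A : {set T})
    (f : T -> 'rV[R]_d) (e : R) : 0 < e -> (0 < d)%N ->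
  (covering_number e [set f x | x in [set` A]] <=
   (size (undup [seq gcell (e / d%:R) (f x) | x in A]))%:R%:E)%E.
Proof.
move=> e0 d0; apply: ereal_inf_lbound => /=.
set s := undup _; exists (size s) => //.
have /choice[c cP] : forall i : 'I_(size s), exists x : 'rV[R]_d,
    gcell (e / d%:R) x = nth [ffun=> 0] s i.
  move=> i; have : nth [ffun=> 0] s i \in s by apply: mem_nth.
  by rewrite mem_undup => /mapP[x _ ->]; exists (f x).
exists c => _ [x xA <-].
have xs : gcell (e / d%:R) (f x) \in s.
  by rewrite mem_undup; apply/mapP; exists x => //; rewrite mem_enum.
have xs' := xs; rewrite -index_mem in xs'.
exists (Ordinal xs'); apply/mem_translate/eballE/enorm_lt => // a.
rewrite !mxE; apply: gcell_dist; first by rewrite divr_gt0// ltr0n.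
by rewrite cP /= nth_index.
Qed.

Lemma covering_number_ge {R : realType} (d : nat) (T : finType) (A : {set T})
    (f : T -> 'rV[R]_d) (e s : R) : 0 < e -> e <= s ->
  {in A &, injective (gcell s \o f)} ->
  ((#|A|%:R / (cell_count d 1)%:R)%:E <= covering_number e [set f x | x in [set` A]])%E.
Proof.
move=> e0 es finj; apply: le_ereal_inf_tmp => _ [n [c Ac] <-].
rewrite lee_fin ler_pdivrMr ?ltr0n ?expn_gt0 ?addn1// -natrM ler_nat.
pose B i := [set x in A | `[< translate (eball e) (c i) (f x) >]].
have AB : (#|A| <= \sum_(i < n) #|B i|)%N.
  have -> : (\sum_(i < n) #|B i| = \sum_(x in A) \sum_(i < n) (x \in B i))%N.
    rewrite exchange_big/=; apply: eq_bigr => i _.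
    rewrite -sum1_card [LHS]big_mkcond [RHS]big_mkcond/=; apply: eq_bigr => x _.
    by rewrite inE; case: (x \in A).
  rewrite -sum1_card; apply: leq_sum => x xA.
  have /= [|i xi] := Ac (f x); first by exists x.
  have xB : x \in B i by rewrite inE xA; apply/asboolP.
  by rewrite (bigD1 i)//= xB.
apply: leq_trans AB _.
have -> : (n * cell_count d 1 = \sum_(i < n) cell_count d 1)%N.
  by rewrite sum_nat_const card_ord.
apply: leq_sum => i _.
apply: (@card_gcell R d 1 _ _ f s (c i)) => [|x y|x].
- exact: lt_le_trans es.
- by rewrite !inE => /andP[xA _] /andP[yA _]; exact: finj.
- rewrite inE => /andP[_ /asboolP/mem_translate/eballE xc] a.
  rewrite mul1r; apply: le_trans es; apply: ltW; apply: le_lt_trans xc.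
  by have := coord_le_enorm (f x - c i) a; rewrite !mxE.
Qed.

(* Members of [A] whose grid cell after projection is over-populated go into
   the exceptional set [B]; they occupy few cells, so if [B] were a large part
   of [A] then [V] would lie in [small_projection]. *)
Lemma projection_fibres {R : realType} (d : nat) (T : finType) (A : {set T})
    (p : T -> 'rV[R]_d) (V : {vspace 'rV[R]_d}) (e s eps tau : R) :
  (0 < d)%N -> 0 < e -> e <= s -> {in A &, injective (gcell s \o p)} ->
  ~ small_projection e eps tau [set p x | x in [set` A]] V ->
  exists B : {set T}, [/\ B \subset A,
    #|B|%:R <= (cell_count d 1)%:R * e `^ eps * #|A|%:R &
    forall (n : nat) (u : 'rV[R]_d),
      #|[set x in A :\: B |
          [forall a, `|proj_along V (p x) 0 a - u 0 a| <= n%:R * e]]|%:R <=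
      (cell_count d (n * d))%:R *
      (2 * (cell_count d 1)%:R * e `^ (- tau) *
       #|A|%:R `^ ((\dim V)%:R / d%:R))].
Proof.
move=> d0 e0 es pinj smallN.
set c1 : R := (cell_count d 1)%:R.
have c11 : 1 <= c1 by rewrite ler1n expn_gt0 addn1.
set a : R := _ / _; set M : R := 2 * _ * _ * _.
pose g x := gcell (e / d%:R) (proj_along V (p x)).
pose B := [set x in A | M < #|[set y in A | g y == g x]|%:R].
exists B.
have BA : B \subset A by apply/fintype.subsetP => x; rewrite inE => /andP[].
split => //; last first.
  move=> n u; set Y := finset _.
  have YM x : x \in Y -> #|[set y in Y | g y == g x]|%:R <= M.
    rewrite !inE => /andP[/andP[xB xA] _].
    move: xB; rewrite xA /= -leNgt; apply: le_trans; rewrite ler_nat.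
    apply: subset_leq_card; apply/fintype.subsetP => y.
    by rewrite !inE => /andP[/andP[/andP[_ ->] _] ->].
  apply: le_trans (card_le_fibres YM) _.
  rewrite ler_wpM2r ?mulr_ge0 ?powR_ge0 ?ler_nat// ?ltW ?(lt_le_trans _ c11)//.
  apply: (@size_undup_gcell R d (n * d) T Y (proj_along V \o p) _ u).
    by rewrite divr_gt0 ?ltr0n.
  move=> x; rewrite inE => /andP[_ /forallP xu] b.
  rewrite natrM -mulrA (mulrC d%:R) divfK ?pnatr_eq0 -?lt0n//; exact: xu.
have [->|[x0 x0B]] := set_0Vmem B.
  by rewrite cards0 !mulr_ge0 ?powR_ge0 ?ler0n.
have N0 : 0 < #|A|%:R :> R.
  by rewrite ltr0n card_gt0; apply/set0Pn; exists x0; exact: (fintype.subsetP BA).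
have M0 : 0 < M by rewrite !mulr_gt0 ?powR_gt0// (lt_le_trans _ c11).
have a01 : 0 <= a <= 1.
  rewrite divr_ge0//= ler_pdivrMr ?ltr0n// mul1r ler_nat.
  by rewrite -[leqRHS](dim_orthv V) leq_addl.
have covA : (covering_number e [set p x | x in [set` A]] <= (#|A|%:R)%:E)%E.
  apply: le_trans (covering_number_le _ _ _ _) _ => //.
  rewrite lee_fin ler_nat; apply: leq_trans (size_undup _) _.
  by rewrite size_map cardE.
have covA' := covering_number_ge e0 es pinj.
have aE : (\dim (orthv V))%:R / d%:R = 1 - a.
  apply: (@mulIf _ d%:R); first by rewrite pnatr_eq0 -lt0n.
  rewrite mulrBl !divfK ?pnatr_eq0 -?lt0n// mul1r.
  have /(congr1 (fun k => k%:R : R)) := dim_orthv V; rewrite natrD => <-.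
  by rewrite addrK.
have small : (covering_number e (proj_along V @` [set p x | x in [set` B]]) <
    (e `^ tau)%:E * covering_number e [set p x | x in [set` A]] `^
      ((\dim (orthv V))%:R / d%:R)%R)%E.
  rewrite image_comp.
  apply: le_lt_trans (covering_number_le _ _ _ _) _ => //.
  set W := size _.
  have WM : W%:R * M <= #|A|%:R.
    apply: le_trans (_ : #|B|%:R <= _); last by rewrite ler_nat subset_leq_card.
    apply: card_ge_fibres => x; rewrite inE => /andP[xA xM].
    apply: le_trans (ltW xM) _; rewrite ler_nat subset_leq_card//.
    apply/fintype.subsetP => y; rewrite !inE => /andP[yA /eqP yx].
    by rewrite yA yx xM /=; exact/eqP.
  apply: (@lt_le_trans _ _ (e `^ tau * (#|A|%:R / c1) `^ (1 - a))%:E); last first.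
    rewrite EFinM lee_pmul2l ?lte_fin ?powR_gt0// -poweR_EFin aE.
    apply: gt0_ler_poweR => //; first by rewrite subr_ge0; case/andP: a01.
    - by rewrite in_itv/= leey andbT lee_fin divr_ge0 ?ltW// (lt_le_trans _ c11).
    - rewrite in_itv/= leey andbT; apply: le_trans covA'.
      by rewrite lee_fin divr_ge0 ?ltW// (lt_le_trans _ c11).
  rewrite lte_fin; apply: (@le_lt_trans _ _ (#|A|%:R / M)).
    by rewrite ler_pdivlMr.
  rewrite ltr_pdivrMr//.
  have c1p : 0 < c1 by rewrite (lt_le_trans _ c11).
  rewrite powRM ?invr_ge0 ?ltW//.
  have -> : e `^ tau * (#|A|%:R `^ (1 - a) * c1^-1 `^ (1 - a)) * M =
     (2 * c1 * c1^-1 `^ (1 - a)) * (e `^ tau * e `^ (- tau)) *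
     (#|A|%:R `^ (1 - a) * #|A|%:R `^ a).
    by rewrite /M -/a; ring.
  rewrite powRN divff ?gt_eqF ?powR_gt0//.
  rewrite -powRD; last by rewrite (gt_eqF N0) implybT.
  rewrite subrK mulr1.
  rewrite powRr1 ?ltW//.
  rewrite ltr_pMl//.
  apply: (@lt_le_trans _ _ (2 * c1 * c1^-1)).
    by rewrite mulfK ?gt_eqF// ltr1n.
  rewrite ler_pM2l ?mulr_gt0//; apply: ger1_powR.
    by rewrite invr_gt0 c1p invf_le1.
  by case/andP: a01 => a0 _; rewrite gerBl.
have : (covering_number e [set p x | x in [set` B]] <
        (e `^ eps)%:E * covering_number e [set p x | x in [set` A]])%E.
  rewrite ltNge; apply/negP => le; apply: smallN.
  exists [set p x | x in [set` B]]; split => //.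
  by move=> _ [x xB <-]; exists x => //; exact: (fintype.subsetP BA).
have covB := covering_number_ge e0 es (sub_in2 (fintype.subsetP BA) pinj).
move=> /(le_lt_trans covB)/ltW/le_trans.
move=> /(_ (e `^ eps * #|A|%:R)%:E); rewrite EFinM lee_pmul2l ?lte_fin ?powR_gt0//.
move=> /(_ covA); rewrite -EFinM lee_fin ler_pdivrMr ?(lt_le_trans _ c11)//.
by move=> /le_trans; apply; rewrite -/c1 mulrC mulrA.
Qed.

(** * Weight classes and telescoping *)

Definition weight_class {R : realType} (X : finType) (C : {set X}) (u : X -> R)
    (W lambda : R) (k : nat) : {set X} :=
  [set x in C | lambda ^+ k.+1 * W < u x <= lambda ^+ k * W].

Lemma card_weight_class {R : realType} (X : finType) (C : {set X}) (u : X -> R)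
    (W lambda : R) (k : nat) : 0 < lambda ->
  (forall x, x \in C -> 0 <= u x) -> \sum_(x in C) u x <= W ->
  #|weight_class C u W lambda k|%:R * (lambda ^+ k.+1 * W) <= W.
Proof.
move=> l0 u0 CW; apply: le_trans CW.
rewrite [leRHS](bigID (mem (weight_class C u W lambda k)))/=.
rewrite -[leLHS]addr0 lerD//; last by apply: sumr_ge0 => x /andP[/u0].
rewrite -sum1_card natr_sum mulr_suml.
rewrite [leRHS](eq_bigl (mem (weight_class C u W lambda k))); last first.
  by move=> x; rewrite !inE; case: (x \in C).
by apply: ler_sum => x; rewrite inE mul1r => /andP[_ /andP[/ltW]].
Qed.

Lemma sum_powR_weight_class {R : realType} (X : finType) (C G : {set X})
    (u : X -> R) (W lambda a M c : R) (K : nat) :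
  0 < lambda -> 0 < a -> 0 <= M -> 0 <= c ->
  (forall x, x \in C -> 0 <= u x) -> \sum_(x in C) u x <= W ->
  G \subset C ->
  (forall k, (k < K)%N -> let Ck := weight_class C u W lambda k in
     #|G :&: Ck|%:R <= M * #|Ck|%:R `^ a) ->
  #|C|%:R * (lambda ^+ K) `^ a <= c ->
  \sum_(x in G) u x `^ a <= (K%:R * M * lambda `^ (- a) + c) * W `^ a.
Proof.
move=> l0 a0 M0 c0 u0 CW GC GM Cc.
have W0 : 0 <= W by apply: le_trans CW; apply: sumr_ge0.
have uW x : x \in C -> u x <= W.
  move=> xC; apply: le_trans CW; rewrite (bigD1 x)//= lerDl sumr_ge0//.
  by move=> y /andP[/u0].
have [W00|Wn0] := eqVneq W 0.
  rewrite big1 ?mulr_ge0 ?addr_ge0 ?powR_ge0 ?mulr_ge0 ?powR_ge0//.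
  move=> x xG; have xC := fintype.subsetP GC x xG.
  have -> : u x = 0 by apply/le_anti; rewrite u0// -W00 uW.
  by rewrite powR0 ?gt_eqF.
have {Wn0}Wp : 0 < W by rewrite lt_neqAle eq_sym Wn0.
pose cls := weight_class C u W lambda.
have cover x : x \in C ->
    (exists2 k : 'I_K, true & x \in cls k) \/ u x <= lambda ^+ K * W.
  move=> xC; elim: K {GM Cc} => [|K IH]; first by right; rewrite expr0 mul1r uW.
  case: IH => [[k _ xk]|uK]; first by left; exists (widen_ord (leqnSn K) k).
  case: (ltP (lambda ^+ K.+1 * W) (u x)) => uK1; last by right.
  by left; exists ord_max => //; rewrite inE xC uK1.
have split_sum : \sum_(x in G) u x `^ a <=
    \sum_(x in G) (\sum_(k < K) (x \in cls k)%:R * u x `^ a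
                    + (u x <= lambda ^+ K * W)%R%:R * u x `^ a).
  apply: ler_sum => x xG.
  have [[k _ xk]|->] := cover x (fintype.subsetP GC x xG); last first.
    by rewrite mul1r lerDr sumr_ge0// => k _; rewrite mulr_ge0 ?powR_ge0.
  rewrite (bigD1 k)//= xk mul1r -addrA lerDl addr_ge0 ?mulr_ge0 ?powR_ge0//.
  by apply: sumr_ge0 => k' _; rewrite mulr_ge0 ?powR_ge0.
apply: le_trans split_sum _.
rewrite big_split/= mulrDl lerD//.
  rewrite exchange_big/=.
  have -> : K%:R * M * lambda `^ (- a) * W `^ a =
      \sum_(k < K) (M * lambda `^ (- a) * W `^ a).
    by rewrite sumr_const card_ord -[RHS]mulr_natl -!mulrA.
  apply: ler_sum => k _.
  apply: (@le_trans _ _ (#|G :&: cls k|%:R * (lambda ^+ k * W) `^ a)).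
    rewrite -sum1_card natr_sum mulr_suml [leRHS]big_mkcond [leLHS]big_mkcond/=.
    apply: ler_sum => x _; rewrite finset.in_setI mul1r; case: (x \in G) => //=.
    case: ifPn => [xk|_]; last by rewrite mul0r.
    move: xk; rewrite mul1r inE => /andP[xC /andP[_ ux]].
    apply: ge0_ler_powR; rewrite ?nnegrE ?(ltW a0) ?u0//.
    by rewrite mulr_ge0 ?exprn_ge0 ?ltW.
  apply: (@le_trans _ _ (M * #|cls k|%:R `^ a * (lambda ^+ k * W) `^ a)).
    by rewrite ler_wpM2r ?powR_ge0//; exact: GM.
  rewrite -!mulrA ler_wpM2l// -!powRM ?mulr_ge0 ?exprn_ge0 ?(ltW l0)//.
  have -> : lambda `^ (- a) = (lambda^-1) `^ a.
    by rewrite -powR_inv1 ?(ltW l0)// -powRrM mulN1r.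
  rewrite -powRM ?invr_ge0 ?(ltW l0)//.
  apply: ge0_ler_powR;
    rewrite ?nnegrE ?(ltW a0) ?mulr_ge0 ?exprn_ge0 ?invr_ge0 ?(ltW l0)//.
  rewrite ler_pdivlMl//; apply: le_trans (card_weight_class k l0 u0 CW).
  by rewrite exprS /cls; lra.
apply: (@le_trans _ _ (\sum_(x in C) (lambda ^+ K * W) `^ a)).
  rewrite [leRHS]big_mkcond [leLHS]big_mkcond/=; apply: ler_sum => x _.
  case xG : (x \in G); last by case: ifP; rewrite ?powR_ge0.
  have xC := fintype.subsetP GC x xG; rewrite xC.
  case ux : (u x <= _); last by rewrite mul0r powR_ge0.
  rewrite mul1r; apply: ge0_ler_powR; rewrite ?nnegrE ?(ltW a0) ?u0//.
  by rewrite mulr_ge0 ?exprn_ge0 ?ltW.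
rewrite sumr_const -mulr_natl powRM ?exprn_ge0 ?(ltW l0)// mulrA.
by rewrite ler_wpM2r ?powR_ge0.
Qed.

(* [rho i] sends a point to the representative of its cell of level [i]. *)
Lemma sum_powR_tree {R : realType} (X : finType) (m : nat) (W : nat -> X -> R)
    (rho : nat -> X -> X) (G : {set X}) (a e b D : nat -> R) (c : R) :
  (forall i x, (i < m)%N -> rho i (rho i.+1 x) = rho i x) ->
  (forall i x, (i <= m)%N -> 0 <= W i x) ->
  a 0%N = e 0%N -> (forall i, (i < m)%N -> a i.+1 = a i + e i.+1) ->
  (forall i, 0 < a i) ->
  (forall i, 0 <= b i) -> (forall i, 0 <= D i) -> 
  (forall i x, (i <= m)%N -> W i x `^ e i <= b i) ->
  (forall i P, (i < m)%N ->
     \sum_(S in rho i.+1 @: G | rho i S == P) W i.+1 S `^ a i <=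
     D i * W i P `^ a i) ->
  #|rho 0%N @: G|%:R <= c ->
  \sum_(S in rho m @: G) W m S `^ a m <=
    c * (\prod_(i < m.+1) b i) * \prod_(i < m) D i.
Proof.
move=> rhorho W0 a0 aS ap b0 D0 We WD Gc.
suff: forall n, (n <= m)%N -> \sum_(S in rho n @: G) W n S `^ a n <=
    c * (\prod_(i < n.+1) b i) * \prod_(i < n) D i by exact.
elim=> [_|n IH nm].
  rewrite big_ord0 mulr1 big_ord1.
  apply: (@le_trans _ _ (\sum_(S in rho 0%N @: G) b 0%N)).
    by apply: ler_sum => S _; rewrite a0; exact: We.
  by rewrite sumr_const -mulr_natl ler_wpM2r.
apply: (@le_trans _ _
   (b n.+1 * \sum_(S in rho n.+1 @: G) W n.+1 S `^ a n)).
  rewrite mulr_sumr; apply: ler_sum => S _.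
  rewrite aS// addrC powRD; last first.
    by rewrite addrC -aS// gt_eqF ?ap.
  by rewrite ler_wpM2r ?powR_ge0//; exact: We.
rewrite big_ord_recr/= [X in _ <= _ * X]big_ord_recr/=.
set c' := c * _.
apply: (@le_trans _ _ (b n.+1 *
    (D n * (c * \prod_(i < n.+1) b i * \prod_(i < n) D i)))); last first.
  by rewrite /c'; lra.
rewrite ler_wpM2l//.
apply: le_trans (_ : D n * \sum_(S in rho n @: G) W n S `^ a n <= _); last first.
  by rewrite ler_wpM2l// IH// ltnW.
rewrite mulr_sumr.
rewrite (partition_big (rho n) (mem (rho n @: G))) /=; last first.
  by move=> S /imsetP[x xG ->]; rewrite rhorho//; exact: imset_f.
by apply: ler_sum => P _; exact: WD.
Qed.

(** * Measures of cells and balls *)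

Lemma sum_measure_le {R : realType} {disp} {T : measurableType disp}
    (mu : {measure set T -> \bar R}) (I : finType) (P : pred I)
    (F : I -> set T) (U : set T) :
  (forall i, measurable (F i)) -> measurable U -> trivIset setT F ->
  (forall i, P i -> F i `<=` U) ->
  (\sum_(i | P i) mu (F i) <= mu U)%E.
Proof.
move=> mF mU tF FU.
rewrite bigfs//; [|exact: index_enum_uniq|by move=> i _; rewrite mem_index_enum].
have finP : finite_set [set` P] by exact: finite_finset.
rewrite -measure_fin_bigcup//; last exact: sub_trivIset tF.
apply: le_measure; rewrite ?inE//; first exact: fin_bigcup_measurable.
by move=> x [i Pi]; exact: FU.
Qed.

Lemma measure_le_sum {R : realType} {disp} {T : measurableType disp}
    (mu : {measure set T -> \bar R}) (I : finType) (P : pred I)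
    (F : I -> set T) (U : set T) :
  (forall i, measurable (F i)) -> measurable U ->
  U `<=` \bigcup_(i in [set` P]) F i ->
  (mu U <= \sum_(i | P i) mu (F i))%E.
Proof.
move=> mF mU UF.
rewrite bigfs//; [|exact: index_enum_uniq|by move=> i _; rewrite mem_index_enum].
have finP : finite_set [set` P] by exact: finite_finset.
exact: content_sub_fsum.
Qed.

Lemma open_measurable_rV {R : realType} {d} (U : set 'rV[R]_d) :
  open U -> measurable (U : set (borel_rV R d)).
Proof. exact: sub_sigma_algebra. Qed.

Lemma measurable_gcell {R : realType} (d : nat) (h : R) (z : {ffun 'I_d -> int}) :
  0 < h -> measurable ([set x | gcell h x = z] : set (borel_rV R d)).
Proof.
move=> h0.
have -> : [set x | gcell h x = z] = \bigcap_(a in [set: 'I_d])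
    ([set x : 'rV[R]_d | x 0 a < (z a + 1)%:~R * h] `\`
     [set x : 'rV[R]_d | x 0 a < (z a)%:~R * h]).
  apply/seteqP; split=> x /=.
    move=> <- a _; rewrite /= ffunE -ltr_pdivrMr// floorD1_gt; split => //.
    by apply/negP; rewrite -leNgt -ler_pdivlMr// floor_le.
  move=> xz; apply/ffunP => a; rewrite ffunE; apply: floor_def.
  have [/= xz1 /negP] := xz a I; rewrite -leNgt => xz2.
  by rewrite ler_pdivlMr// ltr_pdivrMr// xz1 xz2.
have mlt a c : measurable ([set x : 'rV[R]_d | x 0 a < c] : set (borel_rV R d)).
  apply: open_measurable_rV.
  apply: (@open_comp _ _ (fun x : 'rV[R]_d => x 0 a) [set y | y < c]) => [x _|].
    exact: coord_continuous.
  exact: open_lt.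
apply: fin_bigcap_measurable => [|a _]; first exact: finite_finset.
exact: measurableD.
Qed.

Lemma open_translate {R : realType} {d} (U : set 'rV[R]_d) c :
  open U -> open (translate U c).
Proof.
move=> oU.
have -> : translate U c = (fun x => x - c) @^-1` U.
  by apply/seteqP; split=> x /mem_translate.
apply: open_comp => // x _.
by apply: continuousB => //; exact: cst_continuous.
Qed.

Lemma open_eball {R : realType} {d} (e : R) : open (eball e : set 'rV[R]_d).
Proof.
have -> : (eball e : set 'rV[R]_d) = (fun x => enorm x) @^-1` [set y | y < e].
  by apply/seteqP; split=> x /eballE.
apply: open_comp; last exact: open_lt.
move=> x _; apply: (@continuous_comp _ _ _ (fun x => dot x x) Num.sqrt);
  last exact: sqrt_continuous.
rewrite /dot; apply: continuous_big => [|i _ y]; first exact: add_continuous.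
by apply: continuousM; exact: coord_continuous.
Qed.

Lemma open_flag_ball {R : realType} {d m : nat} (V : m.+1.-tuple {vspace 'rV[R]_d})
    (delta : R) r :
  tnth V ord_max = fullv -> open (flag_ball V delta r).
Proof.
move=> Vmax.
have -> : flag_ball V delta r = \bigcup_(u in
    [set u : 'I_m.+1 -> 'rV[R]_d | forall i, vball (tnth V i) (delta `^ r i) (u i)])
    translate (eball (delta `^ r ord_max)) (\sum_(i < m.+1 | i != ord_max) u i).
  apply/seteqP; split=> [x [u uV ->]|x [u uV /mem_translate xu]].
    exists u => //; apply/mem_translate; rewrite (bigD1 ord_max)//= addrK.
    by have := uV ord_max; rewrite Vmax.
  exists (fun i => if i == ord_max then x - \sum_(i < m.+1 | i != ord_max) u i else u i).
    by move=> i; case: eqP => [->|_]; rewrite ?Vmax.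
  rewrite (bigD1 ord_max)//= eqxx [X in _ = _ + X](eq_bigr u) ?subrK//.
  by move=> i /negbTE ->.
apply: bigcup_open => u _; apply: open_translate; exact: open_eball.
Qed.

Lemma dyadic_scale {R : realType} (e : R) : 0 < e <= 1 ->
  exists n : nat, 2 ^- n.+1 < e <= 2 ^- n.
Proof.
move=> /andP[e0 e1].
have ex : exists n, 2 ^- n.+1 < e.
  exists (Num.bound e^-1); rewrite invf_plt ?posrE ?exprn_gt0//.
  by apply: upper_nthrootP.
exists (ex_minn ex); case: ex_minnP => n -> nmin /=.
case: n nmin => [|n] nmin; first by rewrite expr0 invr1.
by rewrite leNgt; apply/negP => /nmin; rewrite ltnn.
Qed.

Lemma gcell_coarsen {R : realType} (d k : nat) (h : R) (x y : 'rV[R]_d) :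
  0 < h -> (0 < k)%N -> gcell h x = gcell h y ->
  gcell (h * k%:R) x = gcell (h * k%:R) y.
Proof.
move=> h0 k0 /ffunP xy; apply/ffunP => a; have := xy a; rewrite !ffunE => e.
have F z (w : 'rV[R]_d) : (z <= Num.floor (w 0 a / (h * k%:R))) =
   (z * k%:Z <= Num.floor (w 0 a / h)).
  rewrite !floor_ge_int intrM -pmulrn invfM mulrA ler_pdivlMr ?ltr0n//.
by apply/le_anti; rewrite !F -{1}e -F lexx e -F lexx.
Qed.

Definition box_shift (d n : nat) (w : {ffun 'I_d -> int})
    (i : {ffun 'I_d -> 'I_(2 * n + 1)}) : {ffun 'I_d -> int} :=
  [ffun a => w a + (i a : nat)%:Z - n%:Z].

Lemma box_shift_surj (d n : nat) (w z : {ffun 'I_d -> int}) :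
  (forall a, `|z a - w a| <= n%:Z) ->
  exists i : {ffun 'I_d -> 'I_(2 * n + 1)}, box_shift w i = z.
Proof.
move=> zw; have b a : (`|(z a - w a + n%:Z)%R| < 2 * n + 1)%N.
  have := zw a.
  have E (u v : int) : `|u - v|%R <= n%:Z ->
    (`|(u - v + n%:Z)%R| < 2 * n + 1)%N by lia.
  exact: E.
exists [ffun a => Ordinal (b a)]; apply/ffunP => a; rewrite !ffunE /=.
have E (u v : int) : `|u - v|%R <= n%:Z ->
  (v + (`|(u - v + n%:Z)%R|%N)%:Z - n%:Z)%R = u by lia.
exact: E.
Qed.

Lemma finite_cells {R : realType} (d : nat) (h : R) : 0 < h ->
  exists (X : finType) (p : X -> 'rV[R]_d), [/\ forall x, eball 1 (p x),
    injective (gcell h \o p) &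
    forall y, eball 1 y -> exists x, gcell h (p x) = gcell h y].
Proof.
move=> h0; pose n := Num.bound h^-1.
have nh : 1 <= n%:R * h.
  rewrite -ler_pdivrMr// div1r; apply/ltW/archi_boundP.
  by rewrite invr_ge0 ltW.
pose I := {ffun 'I_d -> 'I_(2 * n.+1 + 1)}.
pose P (i : I) := `[< exists y : 'rV[R]_d, eball 1 y /\
   gcell h y = box_shift (gcell h 0) i >].
pose X : finType := {i : I | P i}.
have /choice[p pP] : forall x : X, exists y : 'rV[R]_d, eball 1 y /\
    gcell h y = box_shift (gcell h 0) (val x).
  by case=> i /= /asboolP.
exists X, p; split; first by move=> x; case: (pP x).
- move=> x y /=; rewrite (pP x).2 (pP y).2 => /ffunP xy.
  apply/val_inj/ffunP => a; have := xy a; rewrite !ffunE => /addIr /addrI [].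
  exact: val_inj.
- move=> y y1.
  have [|i iy] := @box_shift_surj d n.+1 (gcell h 0) (gcell h y).
    move=> a; apply: gcell_near => //; rewrite mxE subr0.
    apply: le_trans nh; apply/ltW; apply: le_lt_trans (coord_le_enorm _ _) _.
    exact/eballE.
  have Pi : P i by apply/asboolP; exists y.
  by exists (exist _ i Pi); rewrite (pP _).2 /= iy.
Qed.

Lemma measure_box_le {R : realType} (d n : nat)
    (nu : {measure set (borel_rV R d) -> \bar R})
    (U : set (borel_rV R d)) (v : 'rV[R]_d) (e t : R) :
  (0 < d)%N -> 0 < e -> 0 <= t -> measurable U ->
  (forall c, (nu (translate (eball e) c) <= t%:E)%E) ->
  (forall x : 'rV[R]_d, U x -> forall a, `|x 0 a - v 0 a| <= n%:R * e) ->
  (nu U <= ((cell_count d (n * d))%:R * t)%:E)%E.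
Proof.
move=> d0 e0 t0 mU nut Uv.
pose h := e / d%:R; have h0 : 0 < h by rewrite divr_gt0 ?ltr0n.
pose F (i : {ffun 'I_d -> 'I_(2 * (n * d).+1 + 1)}) : set (borel_rV R d) :=
  U `&` [set x | gcell h x = box_shift (gcell h v) i].
have mF i : measurable (F i) by apply: measurableI => //; exact: measurable_gcell.
apply: le_trans (measure_le_sum (P := xpredT) nu mF mU _) _.
  move=> x Ux; have [|i ix] := @box_shift_surj d (n * d).+1 (gcell h v) (gcell h x).
    move=> a; apply: gcell_near => //.
    by rewrite natrM -mulrA (mulrC d%:R) divfK ?pnatr_eq0 -?lt0n//; exact: Uv.
  by exists i.
apply: (@le_trans _ _ (\sum_(i : {ffun 'I_d -> 'I_(2 * (n * d).+1 + 1)}) t%:E)%E).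
  apply: lee_sum => i _; have [->|/set0P[c Fc]] := eqVneq (F i) set0.
    by rewrite measure0 lee_fin.
  apply: le_trans (nut c); apply: le_measure; rewrite ?inE//.
    by apply: open_measurable_rV; apply: open_translate; exact: open_eball.
  move=> x [Ux xi]; apply/mem_translate/eballE/enorm_lt => // a.
  rewrite !mxE; apply: gcell_dist => //; case: Fc => _ ci.
  by rewrite -/h xi ci.
rewrite sumEFin lee_fin sumr_const card_ffun !card_ord.
by rewrite mulrC mulr_natr.
Qed.

(** * Exceptional parameters *)

Lemma markov_sum_indic {R : realType} {disp} {Theta : measurableType disp}
    (sigma : probability Theta R) (I : finType) (c : I -> R)
    (E : I -> set Theta) (q e : R) :
  0 < q -> (forall i, 0 <= c i) -> (forall i, measurable (E i)) ->
  (forall i, (sigma (E i) <= e%:E)%E) ->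
  exists Ex : set Theta, [/\ measurable Ex,
    (sigma Ex <= (q^-1 * (\sum_i c i * e))%:E)%E &
    forall theta, ~ Ex theta -> \sum_i c i * \1_(E i) theta < q].
Proof.
move=> q0 c0 mE sE.
pose g theta : \bar R := (\sum_i ((c i)%:E * (\1_(E i) theta)%:E))%E.
have mi i : measurable_fun [set: Theta] (EFin \o (\1_(E i) : Theta -> R)).
  by apply/measurable_EFinP; exact: measurable_indic.
have mg : measurable_fun [set: Theta] g.
  apply: emeasurable_sum => i; exact: (measurable_funeM (c i)%:E (mi i)).
have gE theta : g theta = (\sum_i c i * \1_(E i) theta)%:E.
  by rewrite -sumEFin; apply: eq_bigr.
have g0 theta : 0 <= \sum_i c i * \1_(E i) theta.
  by apply: sumr_ge0 => i _; rewrite mulr_ge0.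
exists [set theta | (q%:E <= `|g theta|)%E]; split.
- rewrite -[X in measurable X]setTI.
  apply: emeasurable_fun_c_infty => //.
  exact: measurableT_comp.
- rewrite EFinM lee_pdivlMl//.
  have := @le_integral_comp_abse _ _ _ sigma setT measurableT g q id
    (@measurable_id _ _ _) (fun r r0 => r0) (fun x y _ _ xy => xy) mg q0.
  rewrite /= setTI => /le_trans; apply.
  under eq_integral => theta _ do rewrite gee0_abs ?gE ?lee_fin// -gE.
  rewrite (ge0_integral_sum sigma measurableT
    (fun i => measurable_funeM (c i)%:E (mi i))); last first.
    by move=> i x _; rewrite /= mule_ge0 ?lee_fin.
  rewrite -sumEFin; apply: lee_sum => i _.
  rewrite (ge0_integralZl_EFin sigma measurableT _ (mi i) (c0 i)); last first.
    by move=> x _ /=; rewrite lee_fin.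
  rewrite integral_indic// setIT EFinM.
  by apply: lee_wpmul2l; [rewrite lee_fin|exact: sE].
- move=> theta /= /negP; rewrite -ltNge gE gee0_abs ?lee_fin// lte_fin.
Qed.

Lemma level_step_events {R : realType} (d : nat) {disp}
    {Theta : measurableType disp} (sigma : probability Theta R)
    (V : {mfun Theta >-> Gr R d}) (X : finType) (C : {set X})
    (p : X -> 'rV[R]_d) (e s eps tau : R) :
  (0 < d)%N -> 0 < e -> e <= s -> (forall x, eball 1 (p x)) ->
  {in C &, injective (gcell s \o p)} ->
  subcritical (distribution sigma V) e eps tau ->
  exists E : set Theta, [/\ measurable E, (sigma E <= (e `^ eps)%:E)%E &
  forall theta, exists B : {set X}, [/\ B \subset C,
    ~ E theta -> #|B|%:R <= (cell_count d 1)%:R * e `^ eps * #|C|%:R &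
    forall (n : nat) (u : 'rV[R]_d),
      #|[set x in C :\: B |
          [forall a, `|proj_along (V theta) (p x) 0 a - u 0 a| <= n%:R * e]]|%:R <=
      (cell_count d (n * d))%:R *
      (2 * (cell_count d 1)%:R * e `^ (- tau) *
       #|C|%:R `^ ((\dim (V theta : {vspace 'rV[R]_d}))%:R / d%:R))]].
Proof.
move=> d0 e0 es p1 pinj sub.
have [|F [mF sF sigF]] := sub [set p x | x in [set` C]].
  by move=> _ [x _ <-].
exists (V @^-1` F); split => //.
  by rewrite -[X in measurable X]setTI; exact: measurable_funPT.
move=> theta; have [VF|VF] := pselect (F (V theta)).
  exists C; split => // n u; rewrite finset.setDv.
  rewrite (_ : #|_| = 0%N) ?mulr_ge0 ?powR_ge0//.
  by apply: eq_card0 => x; rewrite !inE.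
have [B [BC Be BV]] := projection_fibres d0 e0 es pinj (fun H => VF (sF _ H)).
by exists B; split.
Qed.

(* The weight classes have ratio [e `^ (eps / 2)]: the loss of one such factor
   is affordable both in the fibre counts and in the mass of the bad cells, and
   the number [K] of classes depends only on [d] and [eps]. *)
Lemma level_step {R : realType} (d : nat) {disp}
    {Theta : measurableType disp} (sigma : probability Theta R) (X : finType)
    (V : X -> {mfun Theta >-> Gr R d}) (p : X -> 'rV[R]_d) (par : X -> X)
    (Ch : {set X}) (u W : X -> R) (a e s eps tau c : R) (K : nat) :
  (0 < d)%N -> 0 < e -> e <= s -> (forall x, eball 1 (p x)) ->
  {in Ch &, injective (gcell s \o p)} ->
  (forall P, subcritical (distribution sigma (V P)) e eps tau) ->
  0 < a ->
  (forall P theta, (\dim (V P theta : {vspace 'rV[R]_d}))%:R / d%:R = a) ->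
  (forall S, 0 <= u S) -> (forall P, \sum_(S in Ch | par S == P) u S <= W P) ->
  \sum_P W P <= 1 ->
  let lambda := e `^ (eps / 2) in
  0 <= c -> #|Ch|%:R * (lambda ^+ K) `^ a <= c ->
  exists Ex : set Theta, [/\ measurable Ex, (sigma Ex <= (K%:R * lambda)%:E)%E &
  forall theta, ~ Ex theta -> exists Bad : {set X}, [/\ Bad \subset Ch,
    \sum_(S in Bad) u S <= (1 + (cell_count d 1)%:R * K%:R) * lambda &
    forall (n : nat) (v : 'rV[R]_d) (P : X) (G : {set X}),
      G \subset Ch :\: Bad ->
      (forall S, S \in G -> par S = P /\
         forall b, `|proj_along (V P theta) (p S) 0 b - v 0 b| <= n%:R * e) ->
      \sum_(S in G) u S `^ a <=
        (K%:R * ((cell_count d (n * d))%:R *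
                 (2 * (cell_count d 1)%:R * e `^ (- tau))) * lambda `^ (- a) + c)
        * W P `^ a]].
Proof.
move=> d0 e0 es p1 pinj sub a0 dimV u0 uW W1 lambda c0 Chc.
set c1 : R := (cell_count d 1)%:R.
have l0 : 0 < lambda by rewrite powR_gt0.
have l2 : e `^ eps = lambda * lambda.
  by rewrite -powRD ?(gt_eqF e0) ?implybT// -splitr.
have cl0 : 0 <= c1 * lambda by rewrite mulr_ge0 ?ler0n// ltW.
have W0 P : 0 <= W P by apply: le_trans (uW P); apply: sumr_ge0.
pose CP P := [set S in Ch | par S == P].
have CPW P : \sum_(S in CP P) u S <= W P.
  by rewrite (eq_bigl (fun S => (S \in Ch) && (par S == P)))// => S; rewrite inE.
pose cls (i : X * 'I_K) := weight_class (CP i.1) u (W i.1) lambda i.2.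
have clsCP i : cls i \subset CP i.1.
  by apply/fintype.subsetP => S; rewrite inE => /andP[].
have CPCh P : CP P \subset Ch by apply/fintype.subsetP => S; rewrite inE => /andP[].
have clsinj i : {in cls i &, injective (gcell s \o p)}.
  apply: sub_in2 pinj => S Si; apply: (fintype.subsetP (CPCh i.1)).
  exact: (fintype.subsetP (clsCP i)).
have /choice[E EP] := fun i => level_step_events d0 e0 es p1 (clsinj i) (sub i.1).
have mE i : measurable (E i) by have [] := EP i.
have sE i : (sigma (E i) <= (e `^ eps)%:E)%E by have [] := EP i.
have [Ex [mEx sEx ExP]] :=
  markov_sum_indic (c := fun i => W i.1) l0 (fun i => W0 i.1) mE sE.
have sumW (F : R) : 0 <= F -> \sum_(i : X * 'I_K) W i.1 * F <= K%:R * F.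
  move=> F0; rewrite -mulr_suml ler_wpM2r//.
  rewrite -(pair_bigA _ (fun P (k : 'I_K) => W P))/=.
  under eq_bigr => P _ do rewrite sumr_const card_ord -mulr_natl.
  by rewrite -mulr_sumr -[leRHS]mulr1 ler_wpM2l.
exists Ex; split => //.
  apply: le_trans sEx _; rewrite lee_fin l2 ler_pdivrMl//.
  by apply: le_trans (sumW _ _) _; [rewrite mulr_ge0 ?ltW|lra].
move=> theta /ExP Etheta.
have /choice[B BP] : forall i, exists B : {set X}, [/\ B \subset cls i,
    ~ E i theta -> #|B|%:R <= c1 * e `^ eps * #|cls i|%:R &
    forall (n : nat) (v : 'rV[R]_d),
      #|[set x in cls i :\: B |
          [forall b, `|proj_along (V i.1 theta) (p x) 0 b - v 0 b| <= n%:R * e]]|%:R <=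
      (cell_count d (n * d))%:R *
      (2 * c1 * e `^ (- tau) * #|cls i|%:R `^ a)].
  move=> i; have [_ _ /(_ theta)[B [BC BE BV]]] := EP i.
  by exists B; split => // n v; rewrite -(dimV i.1 theta); exact: BV.
pose Bad := [set S in Ch | [exists k : 'I_K, S \in B (par S, k)]].
exists Bad; split.
- by apply/fintype.subsetP => S; rewrite inE => /andP[].
- have Bi i : \sum_(S in B i) u S <= W i.1 * \1_(E i) theta + W i.1 * (c1 * lambda).
    have [BC BE _] := BP i.
    have [Ei|Ei] := pselect (E i theta).
      rewrite indicE mem_set// mulr1; apply: (@le_trans _ _ (W i.1)); last first.
        by rewrite lerDl mulr_ge0.
      apply: le_trans (CPW i.1).
      rewrite [leRHS]big_mkcond [leLHS]big_mkcond/=; apply: ler_sum => S _.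
      case SB : (S \in B i); last by case: ifP.
      by rewrite (fintype.subsetP (clsCP i))// (fintype.subsetP BC).
    rewrite indicE memNset// mulr0 add0r.
    apply: (@le_trans _ _ (#|B i|%:R * (lambda ^+ i.2 * W i.1))).
      rewrite -sum1_card natr_sum mulr_suml; apply: ler_sum => S SB.
      have := fintype.subsetP BC S SB; rewrite inE mul1r.
      by move=> /andP[_ /andP[]].
    apply: le_trans (_ : (c1 * e `^ eps * #|cls i|%:R) * (lambda ^+ i.2 * W i.1) <= _).
      by rewrite ler_wpM2r ?BE// mulr_ge0 ?exprn_ge0// ltW.
    have := card_weight_class i.2 l0 (fun S _ => u0 S) (CPW i.1).
    rewrite -/(cls i) exprS l2 => H.
    have -> : c1 * (lambda * lambda) * #|cls i|%:R * (lambda ^+ i.2 * W i.1) =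
        (c1 * lambda) * (#|cls i|%:R * (lambda * lambda ^+ i.2 * W i.1)) by ring.
    by rewrite [leRHS]mulrC ler_wpM2l.
  apply: (@le_trans _ _ (\sum_i \sum_(S in B i) u S)).
    have -> : \sum_i \sum_(S in B i) u S = \sum_S \sum_i (S \in B i)%:R * u S.
      rewrite exchange_big/=; apply: eq_bigr => i _.
      rewrite big_mkcond/=; apply: eq_bigr => S _.
      by case: (S \in B i); rewrite ?mul1r ?mul0r.
    rewrite big_mkcond/=; apply: ler_sum => S _; rewrite inE.
    have nn i : true -> 0 <= (S \in B i)%:R * u S by rewrite mulr_ge0.
    case: andP => [[_ /existsP[k Sk]]|_]; last exact: sumr_ge0.
    rewrite (bigD1 (par S, k))//= Sk mul1r lerDl.
    by apply: sumr_ge0 => i _; exact: nn.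
  apply: le_trans (ler_sum _ (fun i _ => Bi i)) _.
  rewrite big_split/= mulrDl mul1r lerD//; first exact: ltW.
  apply: le_trans (sumW _ cl0) _.
  by lra.
- move=> n v P G GCh Gnear.
  apply: sum_powR_weight_class => //.
  + by rewrite !mulr_ge0 ?powR_ge0.
  + apply/fintype.subsetP => S SG; rewrite inE.
    have [-> _] := Gnear S SG; rewrite eqxx andbT.
    by have := fintype.subsetP GCh S SG; rewrite finset.in_setD => /andP[].
  + move=> k kK; rewrite /= -/(cls (P, Ordinal kK)).
    have [_ _ /(_ n v)/= BV] := BP (P, Ordinal kK).
    rewrite -mulrA; apply: le_trans BV; rewrite ler_nat.
    apply: subset_leq_card; apply/fintype.subsetP => S.
    rewrite finset.in_setI => /andP[SG Scls].
    have [parS Sv] := Gnear S SG.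
    have := fintype.subsetP GCh S SG; rewrite finset.in_setD => /andP[SBad SCh].
    rewrite inE finset.in_setD Scls andbT; apply/andP; split; last exact/forallP.
    apply: contra SBad => SB; rewrite inE SCh; apply/existsP.
    by exists (Ordinal kK); rewrite parS.
  + by apply: le_trans Chc; rewrite ler_wpM2r ?powR_ge0// ler_nat subset_leq_card.
Qed.

(** * Dyadic cells and flags *)

Lemma gcell_dyadic_coarsen {R : realType} (d n n' : nat) (x y : 'rV[R]_d) :
  (n <= n')%N -> gcell (2 ^- n') x = gcell (2 ^- n') y ->
  gcell (2 ^- n) x = gcell (2 ^- n) y.
Proof.
move=> nn' xy.
have -> : 2 ^- n = 2 ^- n' * (2 ^ (n' - n))%:R :> R.
  by rewrite natrX -[in LHS](subKn nn') expfB_cond ?pnatr_eq0 ?leq_subr// invf_div mulrC.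
by apply: gcell_coarsen xy; rewrite ?invr_gt0 ?exprn_gt0// expn_gt0.
Qed.

Lemma dyadic_cellE {R : realType} (d n : nat) (z : {ffun 'I_d -> int}) :
  dyadic_cell n%:Z z = [set x : 'rV[R]_d | gcell (2 ^- n) x = z].
Proof.
have h0 : 0 < 2 ^- n :> R by rewrite invr_gt0 exprn_gt0.
apply/seteqP; split=> x /=.
  move=> xz; apply/ffunP => a; rewrite ffunE; apply: floor_def.
  have := xz a; rewrite -exprnN intrD mulr1z.
  by rewrite ler_pdivlMr// ltr_pdivrMr.
move=> <- a; rewrite ffunE -exprnN -ler_pdivlMr// -ltr_pdivrMr//.
by rewrite floor_le /= -[X in _ + X](mulr1z 1) -intrD floorD1_gt.
Qed.

Lemma dyadicP {R : realType} (d n : nat) (eta : R) (Q : set 'rV[R]_d) :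
  2 ^- n.+1 < eta <= 2 ^- n ->
  dyadic d eta Q <->
  exists z : {ffun 'I_d -> int}, Q = [set x | gcell (2 ^- n) x = z].
Proof.
move=> /andP[n1 n2]; split; last first.
  move=> [z ->]; exists n%:Z; split; last by exists z; rewrite -dyadic_cellE.
  by rewrite -exprnN n2 andbT -opprD -PoszD addn1 -exprnN.
move=> [k [/andP[k1 k2] [z Qz]]].
have lt21 : 1 < 2 :> R by rewrite ltr1n.
have kn : k = n%:Z.
  rewrite exprnN in n2; rewrite exprnN in n1.
  have := lt_le_trans k1 n2; have := lt_le_trans n1 k2.
  rewrite !ltr_eXz2l//; lia.
exists [ffun a => z a]; rewrite -dyadic_cellE -kn Qz.
by apply/seteqP; split=> x xz a; have := xz a; rewrite ffunE.
Qed.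

Lemma cell_tree {R : realType} (d m : nat) (n : nat -> nat) :
  (forall i, (i < m)%N -> (n i <= n i.+1)%N) ->
  exists (X : finType) (p : X -> 'rV[R]_d) (rho : nat -> X -> X),
  [/\ forall x, eball 1 (p x), injective (gcell (2 ^- n m : R) \o p),
      forall y : 'rV[R]_d, eball 1 y ->
        exists x, gcell (2 ^- n m) (p x) = gcell (2 ^- n m) y,
      forall i x, gcell (2 ^- n i) (p (rho i x)) = gcell (2 ^- n i) (p x) &
      forall i x y, gcell (2 ^- n i) (p x) = gcell (2 ^- n i) (p y) ->
        rho i x = rho i y].
Proof.
move=> nn; have h0 : 0 < 2 ^- n m :> R by rewrite invr_gt0 exprn_gt0.
have [X [p [p1 pinj psurj]]] := finite_cells d h0.
pose rho i x := odflt x [pick y | gcell (2 ^- n i) (p y) == gcell (2 ^- n i) (p x)].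
exists X, p, rho; split => // [i x|i x y xy]; rewrite /rho.
  by case: pickP => [y /eqP|].
under eq_pick => z do rewrite xy.
by case: pickP => // /(_ y); rewrite eqxx.
Qed.

Lemma flag_ball_proj {R : realType} (d m : nat)
    (V : m.+1.-tuple {vspace 'rV[R]_d}) (delta e : R) (r : 'I_m.+1 -> R)
    (U : {vspace 'rV[R]_d}) (P : pred 'I_m.+1) (v y : 'rV[R]_d) b :
  0 <= e -> (forall k, P k -> (tnth V k <= U)%VS) ->
  (forall k, ~~ P k -> delta `^ r k <= e) ->
  translate (flag_ball V delta r) v y ->
  `|proj_along U y 0 b - proj_along U v 0 b| <= m.+1%:R * e.
Proof.
move=> e0 VU re /mem_translate[u uV yv].
have -> : proj_along U y 0 b - proj_along U v 0 b = (proj_along U (y - v)) 0 b.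
  by rewrite linearB/= !mxE.
rewrite yv linear_sum/= summxE; apply: le_trans (ler_norm_sum _ _ _) _.
apply: (@le_trans _ _ (\sum_(k < m.+1) e)); last first.
  by rewrite sumr_const card_ord mulr_natl.
apply: ler_sum => k _; have [uVk uk] := uV k.
have [Pk|Pk] := boolP (P k).
  by rewrite proj_along_eq0 ?mxE ?normr0//; apply: (subvP (VU k Pk)).
apply: le_trans (coord_le_enorm _ _) _; apply: le_trans (enorm_proj_le _ _) _.
by apply: le_trans (re k Pk); exact: ltW.
Qed.

Lemma enorm_gcell_lt {R : realType} (d : nat) (h : R) (x y : 'rV[R]_d) :
  (0 < d)%N -> 0 < h -> gcell h x = gcell h y -> enorm (x - y) < d%:R * h.
Proof.
move=> d0 h0 xy; apply: enorm_lt; first by rewrite mulr_gt0 ?ltr0n.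
move=> a; rewrite mulrAC divff ?mul1r ?pnatr_eq0 -?lt0n// !mxE.
exact: gcell_dist.
Qed.

Lemma proj_along0 {R : realType} (d : nat) (x : 'rV[R]_d) : proj_along 0 x = x.
Proof.
by have [_] := proj_alongP 0%VS x; rewrite memv0 subr_eq0 => /eqP.
Qed.

(** * Constants and sums over cells *)

Lemma powR_absorb {R : realType} (C eps e : R) : 0 < eps -> 0 <= C ->
  0 < e <= (1 + C) `^ (- (4 / eps)) -> C * e `^ (eps / 4) <= 1.
Proof.
move=> eps0 C0 /andP[e0 ec].
have C1 : 0 < 1 + C by lra.
have : e `^ (eps / 4) <= ((1 + C) `^ (- (4 / eps))) `^ (eps / 4).
  by apply: ge0_ler_powR ec; rewrite ?nnegrE ?powR_ge0 ?divr_ge0// ltW.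
rewrite -powRrM mulNr mulrA divfK ?gt_eqF// divff// powR_inv1 ?(ltW C1)// => H.
apply: le_trans (ler_wpM2l C0 H) _; rewrite ler_pdivrMr// mul1r; lra.
Qed.

Lemma level_constant_le {R : realType} (A c Z e a eps tau : R) :
  0 < e <= 1 -> 0 <= a <= 1 -> 0 < eps -> 0 < tau -> 0 <= A -> 0 <= c -> 0 <= Z ->
  let lambda := e `^ (eps / 2) in
  (A + c) * Z * lambda <= 1 ->
  (A * e `^ (- tau) * lambda `^ (- a) + c) * Z <= e `^ (- (tau + eps)).
Proof.
move=> /andP[e0 e1] /andP[a0 a1] eps0 tau0 A0 c0 Z0 lambda ACZ.
have l0 : 0 < lambda by rewrite powR_gt0.
have l1 : lambda <= 1.
  by rewrite -(powRr0 e); apply: ger_powR; rewrite ?e0 ?divr_ge0// ltW.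
have -> : e `^ (- (tau + eps)) = e `^ (- tau) * lambda^-1 * lambda^-1.
  rewrite -mulrA -invfM -powRD ?(gt_eqF e0) ?implybT// -splitr -powRN.
  by rewrite -powRD ?(gt_eqF e0) ?implybT// opprD.
have t1 : 1 <= e `^ (- tau).
  by rewrite -(powRr0 e); apply: ger_powR; rewrite ?e0 ?oppr_le0// ltW.
have la : lambda `^ (- a) <= lambda^-1.
  by rewrite -powR_inv1 ?(ltW l0)//; apply: ger_powR; rewrite ?l0// lerN2.
have li : 1 <= lambda^-1 by rewrite invf_ge1.
have step : A * e `^ (- tau) * lambda `^ (- a) + c <=
    (A + c) * (e `^ (- tau) * lambda^-1).
  rewrite mulrDl lerD//.
    by rewrite mulrA ler_wpM2l// mulr_ge0 ?powR_ge0.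
  rewrite -[leLHS]mulr1 ler_wpM2l// -[1]mulr1.
  by apply: ler_pM.
apply: le_trans (ler_wpM2r Z0 step) _.
have -> : (A + c) * (e `^ (- tau) * lambda^-1) * Z =
  (e `^ (- tau) * lambda^-1) * ((A + c) * Z) by ring.
rewrite ler_wpM2l//; first by rewrite mulr_ge0 ?powR_ge0// invr_ge0 ltW.
by rewrite -div1r ler_pdivlMr.
Qed.

(* The lower bound on [K]: the cells lighter than the last weight class are
   negligible, although there may be as many as (5 / e) ^ d of them. *)
Lemma tiny_class_le {R : realType} (d n K : nat) (e a eps : R) :
  (0 < d)%N -> 0 < e <= 2 ^- n -> e <= 1 -> d%:R^-1 <= a -> 0 < eps ->
  2 * d%:R ^+ 2 / eps <= K%:R ->
  (cell_count d (2 ^ n))%:R * ((e `^ (eps / 2)) ^+ K) `^ a <= 5 ^+ d.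
Proof.
move=> d0 /andP[e0 en] e1 da eps0 Kd.
have dp : 0 < d%:R :> R by rewrite ltr0n.
have exponent : d%:R <= eps / 2 * K%:R * a.
  apply: (@le_trans _ _ (eps / 2 * (2 * d%:R ^+ 2 / eps) * d%:R^-1)).
    rewrite le_eqVlt; apply/orP; left; apply/eqP.
    by field; rewrite ?gt_eqF.
  have eps2 : 0 <= eps / 2 by rewrite divr_ge0// ltW.
  have Kd0 : 0 <= 2 * d%:R ^+ 2 / eps :> R.
    by rewrite divr_ge0 ?(ltW eps0)// mulr_ge0.
  apply: ler_pM => //; first exact: mulr_ge0.
  exact: ler_wpM2l.
rewrite -powR_mulrn ?powR_ge0// -!powRrM.
have pe : e `^ (eps / 2 * K%:R * a) <= e ^+ d.
  by rewrite -powR_mulrn ?(ltW e0)//; apply: ger_powR; rewrite ?e0.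
have cnt : (cell_count d (2 ^ n))%:R <= (5 * 2 ^+ n) ^+ d :> R.
  rewrite /cell_count natrX ler_pXn2r ?nnegrE ?mulr_ge0 ?exprn_ge0//.
  rewrite natrD natrM -[(2 ^ n).+1%:R]natr1 natrX.
  have : 1 <= 2 ^+ n :> R by rewrite exprn_ege1// ler1n.
  by set z := 2 ^+ n; lra.
have H := ler_pM (ler0n _ _) (powR_ge0 _ _) cnt pe.
rewrite mulrA; apply: le_trans H _.
rewrite -exprMn ler_pXn2r ?nnegrE ?mulr_ge0 ?exprn_ge0 ?(ltW e0)//.
rewrite -mulrA -[leRHS]mulr1 ler_pM2l// mulrC -ler_pdivlMr ?exprn_gt0//.
by rewrite div1r.
Qed.

Lemma sum_cells_children {R : realType} (X : finType) (w : X -> R)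
    (rho rho' : X -> X) (P : X) : (forall x, rho (rho' x) = rho x) ->
  \sum_(S in rho' @: [set: X]%SET | rho S == P) \sum_(x | rho' x == S) w x =
  \sum_(x | rho x == P) w x.
Proof.
move=> rhorho.
rewrite [RHS](partition_big rho'
  (fun S => (S \in rho' @: [set: X]%SET) && (rho S == P)))/=; last first.
  by move=> x /eqP xP; rewrite imset_f ?inE//= rhorho xP.
apply: eq_bigr => S /andP[_ /eqP SP]; apply: eq_bigl => x.
case: eqP => [xS|_]; last by rewrite andbF.
by rewrite andbT -SP -xS rhorho eqxx.
Qed.

Lemma sum_cells_preim {R : realType} (X : finType) (w : X -> R)
    (rho : X -> X) (B : {set X}) :
  \sum_(S in B) \sum_(x | rho x == S) w x = \sum_(x | rho x \in B) w x.
Proof.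
rewrite [RHS](partition_big rho (mem B))//=.
apply: eq_bigr => S SB; apply: eq_bigl => x.
by case: (eqVneq (rho x) S) => [->|]; rewrite ?andbF// SB.
Qed.

Lemma sum_exists_le {R : realType} (X : finType) (m : nat) (w : X -> R)
    (B : 'I_m -> pred X) : (forall x, 0 <= w x) ->
  \sum_(x | [exists i, B i x]) w x <= \sum_i \sum_(x | B i x) w x.
Proof.
move=> w0; under [leRHS]eq_bigr => i _ do rewrite big_mkcond.
rewrite exchange_big/= big_mkcond/=; apply: ler_sum => x _.
have nn i : true -> 0 <= (if B i x then w x else 0) by case: ifP.
case: existsP => [[i Bi]|_]; last by apply: sumr_ge0 => i _; exact: nn.
rewrite (bigD1 i)//= Bi lerDl; apply: sumr_ge0 => k _; exact: nn.
Qed.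

Lemma powR_prod {R : realType} (I : finType) (F : I -> R) (s : R) :
  (forall i, 0 <= F i) -> (\prod_i F i) `^ s = \prod_i F i `^ s.
Proof.
move=> F0; suff [] : 0 <= \prod_i F i /\ (\prod_i F i) `^ s = \prod_i F i `^ s by [].
apply: (big_rec2 (fun x y => 0 <= x /\ x `^ s = y)); first by rewrite powR1.
by move=> i x _ _ [x0 <-]; rewrite mulr_ge0 ?powRM.
Qed.

Theorem theorem3p2 (R : realType) :
  exists c : R, 0 < c /\
  forall (d : nat) (eps : R), 0 < eps ->
  exists c' : R, 0 < c' /\
  forall (m : nat), (1 <= m)%N -> (m < d)%N ->
  forall j : 'I_m.+1 -> nat, composition (d := d) j ->
  forall r : 'I_m.+1 -> R,
    0 <= r ord0 -> (forall i k : 'I_m.+1, (i < k)%N -> r i < r k) ->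
    r ord_max <= 1 ->
  forall delta : R, 0 < delta < 1 ->
  forall eta : R, delta `^ r ord0 <= eta <= 1 ->
  forall tau eps' : R, 0 < tau -> 0 < eps' ->
  forall (disp : measure_display) (Theta : measurableType disp)
    (sigma : probability Theta R)
    (V : dyadic d eta -> {mfun Theta >-> m.+1.-tuple (Gr R d)}),
    (forall Q theta, flag j (V Q theta)) ->
    (forall Q (i : 'I_m),
      subcritical (distribution sigma (flag_comp (V Q) (widen_ord (leqnSn m) i)))
        (delta `^ r (lift ord0 i)) eps tau) ->
  forall nu : {measure set (borel_rV R d) -> \bar R},
    nu (~` eball 1) = 0%E -> (nu setT <= 1)%E ->
  forall t : 'I_m.+1 -> R, (forall i, 0 < t i) ->
    (forall (i : 'I_m.+1) (v : 'rV[R]_d),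
      (nu (translate (eball (delta `^ r i)) v) <= (t i)%:E)%E) ->
  eps' <= c * eps -> delta `^ r (inord 1) <= c' ->
  exists E : set Theta, [/\ measurable E,
    (sigma E <= (delta `^ (r (inord 1) * eps'))%:E)%E &
    forall theta, ~ E theta ->
    exists F : set (borel_rV R d), [/\ measurable F,
      (nu F <= (delta `^ (r (inord 1) * eps'))%:E)%E &
      forall (Q : dyadic d eta) (v : 'rV[R]_d),
        (nu (translate (flag_ball (V Q theta) delta r) v `&` (\val Q `\` F)) <=
         (delta `^ (- ((tau + eps) * \sum_(i < m) r (lift ord0 i))) *
          \prod_(i < m.+1) t i `^ ((j i)%:R / d%:R))%:E)%E]].
Proof.
exists (1 / 4); split; first by lra.
move=> d eps eps0.
pose K := Num.bound (2 * d%:R ^+ 2 / eps).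
have KP : 2 * d%:R ^+ 2 / eps <= K%:R.
  apply/ltW/archi_boundP; rewrite divr_ge0 ?(ltW eps0)// mulr_ge0//.
pose c1 : R := (cell_count d 1)%:R.
pose c2 : R := (cell_count d (2 * d))%:R.
pose c3 : R := (cell_count d (3 * d))%:R.
pose cn : R := (cell_count d (3 * d * d))%:R.
pose A : R := K%:R * (cn * (2 * c1)).
pose Z : R := c2 * c2 * c3.
pose C : R := (A + 5 ^+ d) * Z + d%:R * (K%:R + (1 + c1 * K%:R)).
have cc_ge1 n : 1 <= (cell_count d n)%:R :> R.
  by rewrite ler1n expn_gt0 addn1.
have A0 : 0 <= A by rewrite !mulr_ge0.
have Z0 : 0 <= Z by rewrite !mulr_ge0.
have C1 : 0 <= (A + 5 ^+ d) * Z by rewrite mulr_ge0 ?addr_ge0 ?exprn_ge0.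
have C2 : 0 <= d%:R * K%:R :> R by rewrite mulr_ge0.
have C3 : 0 <= d%:R * (1 + c1 * K%:R) by rewrite mulr_ge0 ?addr_ge0 ?mulr_ge0.
have CE : C = (A + 5 ^+ d) * Z + (d%:R * K%:R + d%:R * (1 + c1 * K%:R)).
  by rewrite /C mulrDr.
have C0 : 0 <= C by rewrite CE; lra.
have C1C : (A + 5 ^+ d) * Z <= C by rewrite CE; lra.
have C2C : d%:R * K%:R <= C by rewrite CE; lra.
have C3C : d%:R * (1 + c1 * K%:R) <= C by rewrite CE; lra.
have eps2 : eps / 2 = eps / 4 + eps / 4 by lra.
exists ((1 + C) `^ (- (4 / eps))); split; first by rewrite powR_gt0//; lra.
move=> m m1 md j [j0 jd] r r0 rlt r1 delta /andP[de0 de1] eta /andP[eta1 eta2].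
move=> tau eps' tau0 eps'0 disp Theta sigma V flagV subV nu nu0 nu1 t t0 nut.
move=> eps'le dc'.
have d0 : (0 < d)%N by apply: leq_trans md.
have dne : d%:R != 0 :> R by rewrite pnatr_eq0 -lt0n.
pose ee k := delta `^ r (inord k).
have rmono (i k : 'I_m.+1) : (i <= k)%N -> r i <= r k.
  by rewrite leq_eqVlt => /orP[/eqP/val_inj->//|/rlt/ltW].
have rge0 i : 0 <= r i by apply: le_trans r0 _; apply: rmono.
have dmono (i k : 'I_m.+1) : (i <= k)%N -> delta `^ r k <= delta `^ r i.
  by move=> ik; apply: ger_powR; [rewrite de0 ltW|exact: rmono].
have ee01 k : 0 < ee k <= 1.
  rewrite powR_gt0//= -(powRr0 delta); apply: ger_powR => //.
  by rewrite de0 ltW.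
have eemono i k : (i <= k <= m)%N -> ee k <= ee i.
  by move=> /andP[ik km]; apply: dmono; rewrite !inordK ?ltnS//; exact: leq_trans km.
have /choice[n nP] : forall k, exists n, 2 ^- n.+1 < ee k <= 2 ^- n.
  by move=> k; exact: dyadic_scale.
have nmono i : (i < m)%N -> (n i <= n i.+1)%N.
  move=> im; have /andP[h1 _] := nP i.+1; have /andP[_ h2] := nP i.
  have := lt_le_trans h1 (le_trans (eemono i i.+1 _) h2).
  rewrite leqnSn im => /(_ isT).
  by rewrite ltf_pV2 ?posrE ?exprn_gt0// ltr_eXn2l ?ltr1n// ltnS.
have eta0 : 0 < eta by apply: lt_le_trans eta1; rewrite powR_gt0.
have [nQ nQP] : exists nQ, 2 ^- nQ.+1 < eta <= 2 ^- nQ.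
  by apply: dyadic_scale; rewrite eta0.
have nQ0 : (nQ <= n 0%N)%N.
  have /andP[h1 _] := nP 0%N; have /andP[_ h2] := nQP.
  have e0E : ee 0%N = delta `^ r ord0.
    by rewrite /ee; congr (_ `^ r _); apply/val_inj; rewrite /= inordK.
  have := lt_le_trans h1 (le_trans _ h2); rewrite e0E => /(_ eta1).
  by rewrite ltf_pV2 ?posrE ?exprn_gt0// ltr_eXn2l ?ltr1n// ltnS.
have [X [p [rho [p1 pinj psurj rhoP rhoeq]]]] := @cell_tree R d m n nmono.
have gmono i k (x y : 'rV[R]_d) : (i <= k <= m)%N ->
    gcell (2 ^- n k) x = gcell (2 ^- n k) y ->
    gcell (2 ^- n i) x = gcell (2 ^- n i) y.
  move=> /andP[ik km]; apply: gcell_dyadic_coarsen.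
  elim: k ik km => [|k IH]; first by rewrite leqn0 => /eqP->.
  rewrite leq_eqVlt => /orP[/eqP->//|]; rewrite ltnS => ik km.
  by apply: leq_trans (IH ik (ltnW km)) (nmono k km).
have gfine i (x y : 'rV[R]_d) : (i <= m)%N ->
    gcell (2 ^- n m) x = gcell (2 ^- n m) y ->
    gcell (2 ^- n i) x = gcell (2 ^- n i) y.
  by move=> im; apply: gmono; rewrite im leqnn.
have rhorho i x : (i < m)%N -> rho i (rho i.+1 x) = rho i x.
  move=> im; apply: rhoeq; apply: (gmono i i.+1); last exact: rhoP.
  by rewrite leqnSn.
have rhom x : rho m x = x by apply: pinj => /=; exact: rhoP.
have side0 k : 0 < 2 ^- k :> R by rewrite invr_gt0 exprn_gt0.
have side2 k : 2 ^- n k <= 2 * ee k.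
  have /andP[h1 _] := nP k; move: h1; rewrite exprS invfM => h1.
  by rewrite -ler_pdivrMl// ltW.
pose at_ x : set (borel_rV R d) := [set y | gcell (2 ^- n m) y = gcell (2 ^- n m) (p x)].
have mat x : measurable (at_ x) by exact: measurable_gcell.
have nule B : measurable B -> (nu B <= 1)%E.
  by move=> mB; apply: le_trans nu1; apply: le_measure; rewrite ?inE.
pose w x := fine (nu (at_ x)).
have wE x : nu (at_ x) = (w x)%:E.
  rewrite fineK// ge0_fin_numE//; apply: le_lt_trans (nule _ (mat x)) _.
  exact: ltry.
have w0 x : 0 <= w x by rewrite fine_ge0.
have tat : trivIset [set: X] at_.
  apply/trivIsetP => x y _ _ /eqP xy; apply/seteqP; split=> // z [zx zy].
  by apply: xy; apply: pinj => /=; rewrite -zx -zy.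
pose W i P := \sum_(x | rho i x == P) w x.
have W0 i P : 0 <= W i P by exact: sumr_ge0.
have Wsum i : \sum_P W i P <= 1.
  have -> : \sum_P W i P = \sum_x w x by rewrite [RHS](partition_big (rho i) xpredT).
  rewrite -lee_fin -sumEFin; apply: le_trans (nule setT measurableT).
  rewrite (eq_bigr (fun x => nu (at_ x)))//.
  exact: sum_measure_le.
have Wt (k : 'I_m.+1) P : W k P <= c2 * t k.
  rewrite -lee_fin -sumEFin (eq_bigr (fun x => nu (at_ x)))//.
  apply: (@le_trans _ _ (nu [set y | gcell (2 ^- n k) y = gcell (2 ^- n k) (p P)])).
    apply: sum_measure_le => //; first exact: measurable_gcell.
    move=> x /eqP xP y /= yx; rewrite -xP rhoP; apply: gmono yx.
    by rewrite -ltnS ltn_ord /=.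
  have eek : ee k = delta `^ r k by rewrite /ee inord_val.
  apply: (@measure_box_le R d 2 nu _ (p P) (delta `^ r k)) => //.
  - by rewrite powR_gt0.
  - exact: ltW.
  - exact: measurable_gcell.
  - move=> x /= xP b; apply: le_trans (ltW (gcell_dist b (side0 _) xP)) _.
    by rewrite -eek.
have /choice[Qof QofP] : forall x, exists Q : dyadic d eta,
    \val Q = [set y | gcell (2 ^- nQ) y = gcell (2 ^- nQ) (p x)].
  move=> x; have H : dyadic d eta [set y | gcell (2 ^- nQ) y = gcell (2 ^- nQ) (p x)].
    by apply/(dyadicP _ nQP); exists (gcell (2 ^- nQ) (p x)).
  by exists (SigSub (mem_set H)).
pose a i : R := (\sum_(k < m.+1 | (k <= i)%N) j k)%:R / d%:R.
have a_gt0 i : 0 < a i.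
  by rewrite divr_gt0 ?ltr0n// (bigD1 ord0)//= addn_gt0 j0.
have a_ge i : d%:R^-1 <= a i.
  rewrite -[leLHS]mul1r ler_pM2r ?invr_gt0 ?ltr0n// ler1n (bigD1 ord0)//=.
  by rewrite addn_gt0 j0.
have a_le i : a i <= 1.
  rewrite ler_pdivrMr ?ltr0n// mul1r ler_nat -[leqRHS]jd.
  by rewrite [leqRHS](bigID (fun k : 'I_m.+1 => (k <= i)%N))/= leq_addr.
have a_step i : (i < m)%N -> a i.+1 = a i + (j (inord i.+1))%:R / d%:R.
  move=> im; rewrite -mulrDl -natrD; congr (_%:R / _).
  rewrite (bigD1 (inord i.+1 : 'I_m.+1)) /= ?inordK ?ltnS// addnC.
  congr (_ + _)%N; apply: eq_bigl => k.
  by rewrite -val_eqE /= inordK ?ltnS// andbC -ltn_neqAle ltnS.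
have a_0 : a 0%N = (j (inord 0))%:R / d%:R.
  have -> : inord 0 = ord0 :> 'I_m.+1 by apply/val_inj; rewrite /= inordK.
  rewrite /a (bigD1 ord0)//= big1 ?addn0// => k /andP[].
  by rewrite leqn0 -val_eqE /= => ->.
have a_m : a m = 1.
  rewrite /a (eq_bigl xpredT) ?jd ?divff// => k.
  by rewrite -ltnS ltn_ord.
have eeS (i : 'I_m) : delta `^ r (lift ord0 i) = ee i.+1.
  rewrite /ee; congr (_ `^ r _); apply/val_inj.
  by rewrite /= inordK ?ltnS// /bump.
pose Ch (i : 'I_m) := rho i.+1 @: [set: X]%SET.
pose lam (i : 'I_m) := ee i.+1 `^ (eps / 2).
pose VV (i : 'I_m) P : {mfun Theta >-> Gr R d} :=
  flag_comp (V (Qof P)) (widen_ord (leqnSn m) i).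
have dimVV (i : 'I_m) P theta :
    (\dim (VV i P theta : {vspace 'rV[R]_d}))%:R / d%:R = a i.
  have [_ _ _ /(_ (widen_ord (leqnSn m) i)) dimE] := flagV (Qof P) theta.
  by rewrite /a -dimE.
have eep k : 0 < ee k by have /andP[] := ee01 k.
have ee1 k : ee k <= 1 by have /andP[] := ee01 k.
have eeside k : ee k <= 2 ^- n k by have /andP[] := nP k.
have rhoinj i (D : {set X}) :
    {in rho i @: D &, injective (gcell (2 ^- n i) \o p)}.
  move=> _ _ /imsetP[x _ ->] /imsetP[y _ ->] /=; rewrite !rhoP.
  exact: rhoeq.
have subVV (i : 'I_m) P : subcritical (distribution sigma (VV i P)) (ee i.+1) eps tau.
  by rewrite -eeS; exact: subV.
have childW (i : 'I_m) P :
    \sum_(S in Ch i | rho i S == P) W i.+1 S <= W i P.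
  by rewrite sum_cells_children// => x; exact: rhorho.
have tiny (i : 'I_m) : #|Ch i|%:R * (lam i ^+ K) `^ a i <= 5 ^+ d.
  have ei : 0 < ee i.+1 <= 2 ^- n i.+1 by rewrite eep eeside.
  apply: le_trans (tiny_class_le d0 ei (ee1 i.+1) (a_ge i) eps0 KP).
  rewrite ler_wpM2r ?powR_ge0// ler_nat.
  apply: (@card_gcell R d _ X (Ch i) p (2 ^- n i.+1) 0) => // [|x _ b].
    exact: (@rhoinj i.+1 [set: X]%SET).
  rewrite mxE subr0 natrX mulfV ?gt_eqF ?exprn_gt0//.
  by apply: le_trans (coord_le_enorm _ _) _; apply/ltW/eballE.
have pow5 : 0 <= 5 ^+ d :> R by rewrite exprn_ge0.
have /choice[Ex ExP] := fun i : 'I_m => level_step d0 (eep i.+1) (eeside i.+1) p1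
  (@rhoinj i.+1 [set: X]%SET) (subVV i) (a_gt0 i) (dimVV i) (W0 i.+1) (childW i)
  (Wsum i) pow5 (tiny i).
have eps4 : 0 <= eps / 4 by rewrite divr_ge0// ltW.
have absorb : C * ee 1%N `^ (eps / 2) <= ee 1%N `^ eps'.
  apply: (@le_trans _ _ (ee 1%N `^ (eps / 4))); last first.
    apply: ger_powR => //; apply: le_trans eps'le _.
    by rewrite mulrC mulrA mulr1.
  rewrite eps2 powRD ?(gt_eqF (eep _)) ?implybT// mulrA ler_piMl ?powR_ge0//.
  by apply: powR_absorb => //; rewrite eep.
have lam1 (i : 'I_m) : lam i <= ee 1%N `^ (eps / 2).
  apply: ge0_ler_powR; rewrite ?nnegrE ?(ltW (eep _)) ?divr_ge0 ?(ltW eps0)//.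
  by apply: eemono; rewrite ltn_ord.
have lam0 (i : 'I_m) : 0 < lam i by rewrite powR_gt0.
have absorb1 : C * ee 1%N `^ (eps / 2) <= 1.
  apply: le_trans absorb _; rewrite -(powRr0 (ee 1%N)).
  by apply: ger_powR => //; exact: ltW.
pose L := ee 1%N `^ (eps / 2); have L0 : 0 <= L by exact: powR_ge0.
have sumlam (F : R) : 0 <= F -> \sum_(i < m) F * lam i <= d%:R * F * L.
  move=> F0; apply: (@le_trans _ _ (\sum_(i < m) F * L)).
    by apply: ler_sum => i _; rewrite ler_wpM2l//; exact: lam1.
  rewrite sumr_const card_ord -[leLHS]mulr_natl -mulrA ler_wpM2r ?mulr_ge0//.
  by rewrite ler_nat ltnW.
have eps'E : delta `^ (r (inord 1) * eps') = ee 1%N `^ eps' by rewrite powRrM.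
exists (\bigcup_(i in [set: 'I_m]) Ex i); split.
- by apply: fin_bigcup_measurable => [|i _]; [exact: finite_finset|have [] := ExP i].
- rewrite eps'E; apply: le_trans (measure_le_sum (P := xpredT) sigma (F := Ex) _ _ _) _.
  + by move=> i; have [] := ExP i.
  + by apply: fin_bigcup_measurable => [|i _]; [exact: finite_finset|have [] := ExP i].
  + by move=> x [i _ xi]; exists i.
  apply: (@le_trans _ _ (\sum_(i < m) (K%:R * lam i)%:E)%E).
    by apply: lee_sum => i _; have [] := ExP i.
  rewrite sumEFin lee_fin; apply: le_trans (sumlam _ _) _ => //.
  by apply: le_trans absorb; rewrite ler_wpM2r.
move=> theta nEx.
have /choice[Bad BadP] := fun i : 'I_m =>
  let: And3 _ _ H := ExP i in H theta (fun Hi => nEx (ex_intro2 _ _ i I Hi)).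
pose BadX x := [exists i : 'I_m, rho i.+1 x \in Bad i].
pose F : set (borel_rV R d) := \bigcup_(x in [set` BadX]) at_ x.
have mF : measurable F.
  by apply: fin_bigcup_measurable => // ; exact: finite_finset.
exists F; split => //.
  rewrite eps'E; apply: le_trans (measure_le_sum nu mat mF (P := BadX) _) _ => //.
  under eq_bigr => x _ do rewrite wE.
  rewrite sumEFin lee_fin; apply: le_trans (sum_exists_le _ w0) _.
  apply: (@le_trans _ _ (\sum_(i < m) (1 + c1 * K%:R) * lam i)).
    apply: ler_sum => i _; rewrite -sum_cells_preim.
    by have [_ + _] := BadP i.
  apply: le_trans (sumlam _ _) _; first by rewrite addr_ge0 ?mulr_ge0.
  by apply: le_trans absorb; rewrite ler_wpM2r.
move=> Q v; set B := translate _ v.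
pose G := [set x | [&& ~~ BadX x, `[< Qof x = Q >] & `[< B `&` at_ x !=set0 >]]]%SET.
have Vmax : tnth (V Q theta) ord_max = fullv by have [] := flagV Q theta.
have Bop : open B by apply: open_translate; exact: open_flag_ball.
have mB : measurable (B : set (borel_rV R d)) := open_measurable_rV Bop.
have mQ : measurable (\val Q : set (borel_rV R d)).
  have /(dyadicP _ nQP)[z ->] := set_mem (valP Q).
  exact: measurable_gcell.
have QofE x y : gcell (2 ^- nQ) (p x) = gcell (2 ^- nQ) y -> (\val Q) y -> Qof x = Q.
  move=> xy Qy; apply: val_inj; rewrite QofP.
  have /(dyadicP _ nQP)[z Qz] := set_mem (valP Q).
  by move: Qy; rewrite Qz /= => <-; rewrite xy.
have Qrho i x : (i <= m)%N -> Qof (rho i x) = Qof x.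
  move=> im; apply: val_inj; rewrite !QofP.
  have -> // : gcell (2 ^- nQ) (p (rho i x)) = gcell (2 ^- nQ) (p x).
  apply: (gcell_dyadic_coarsen nQ0); apply: (gmono 0%N i); last exact: rhoP.
  by rewrite im.
have mE1 : measurable (eball 1 : set (borel_rV R d)).
  by apply: open_measurable_rV; exact: open_eball.
pose U : set (borel_rV R d) := \bigcup_(x in [set` G]) at_ x.
have mU : measurable U.
  by apply: fin_bigcup_measurable => //; exact: finite_finset.
have nuG : (nu (B `&` (\val Q `\` F)) <= (\sum_(x in G) w x)%:E)%E.
  apply: (@le_trans _ _ (nu (U `|` ~` eball 1))).
    apply: le_measure; rewrite ?inE.
    - by apply: measurableI => //; exact: measurableD.
    - by apply: measurableU => //; exact: measurableC.
    move=> y [By [Qy nFy]]; have [y1|] := pselect (eball 1 y); last by right.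
    left; have [x xy] := psurj y y1; exists x => //=.
    rewrite inE; apply/and3P; split.
    - by apply/negP => bx; apply: nFy; exists x.
    - apply/asboolP; apply: QofE Qy; apply: (gcell_dyadic_coarsen nQ0).
      exact: gfine.
    - by apply/asboolP; exists y.
  apply: le_trans (measureU2 _ mU (measurableC mE1)) _.
  rewrite [X in (_ + X)%E](_ : _ = 0%E); last exact: nu0.
  rewrite adde0 -sumEFin -(eq_bigr _ (fun x _ => wE x)).
  exact: measure_le_sum.
have near x : x \in G -> Qof x = Q /\ exists2 y, B y &
    gcell (2 ^- n m) (p x) = gcell (2 ^- n m) y.
  rewrite inE => /and3P[_ /asboolP Qx /asboolP[y [By xy]]]; split => //.
  by exists y.
have mdR : m.+1%:R <= d%:R :> R by rewrite ler_nat.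
have Gnear (i : 'I_m) S : S \in rho i.+1 @: G -> forall b,
    `|proj_along (VV i (rho i S) theta) (p S) 0 b -
      proj_along (tnth (V Q theta) (widen_ord (leqnSn m) i)) v 0 b| <=
    (3 * d)%:R * ee i.+1.
  move=> /imsetP[x xG ->] b; have [Qx [y By xy]] := near x xG.
  rewrite /VV /= /flag_comp !Qrho ?(ltnW (ltn_ord i))// Qx.
  set Vi := tnth _ _.
  have yv : `|proj_along Vi y 0 b - proj_along Vi v 0 b| <= m.+1%:R * ee i.+1.
    apply: (flag_ball_proj (P := fun k => (k <= i)%N) b (ltW (eep _)) _ _ By).
      have [_ _ Vmono _] := flagV Q theta.
      move=> k ki; have [ki'|ki'] := ltnP k i.
        by have [] := Vmono k (widen_ord (leqnSn m) i) ki'.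
      have -> // : k = widen_ord (leqnSn m) i.
      by apply/val_inj/eqP; rewrite eqn_leq /= ki ki'.
    move=> k; rewrite -ltnNge => ik; rewrite -eeS; apply: dmono.
    by rewrite /= /bump.
  have Sy : `|proj_along Vi (p (rho i.+1 x)) 0 b - proj_along Vi y 0 b| <=
      d%:R * (2 * ee i.+1).
    have -> : proj_along Vi (p (rho i.+1 x)) 0 b - proj_along Vi y 0 b =
        (proj_along Vi (p (rho i.+1 x) - y)) 0 b by rewrite linearB/= !mxE.
    apply: le_trans (coord_le_enorm _ _) _.
    apply: le_trans (enorm_proj_le _ _) _.
    apply: le_trans (ltW (enorm_gcell_lt d0 (side0 (n i.+1)) _)) _.
      rewrite rhoP; exact: gfine.
    by rewrite ler_wpM2l.
  have -> : proj_along Vi (p (rho i.+1 x)) 0 b - proj_along Vi v 0 b =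
    (proj_along Vi (p (rho i.+1 x)) 0 b - proj_along Vi y 0 b) +
    (proj_along Vi y 0 b - proj_along Vi v 0 b) by ring.
  apply: le_trans (ler_normD _ _) _; apply: le_trans (lerD Sy yv) _.
  have -> : (3 * d)%:R * ee i.+1 = d%:R * (2 * ee i.+1) + d%:R * ee i.+1.
    by rewrite natrM; ring.
  by rewrite lerD2l ler_wpM2r// ltW.
have card0 : #|rho 0%N @: G|%:R <= c3.
  rewrite ler_nat.
  apply: (@card_gcell R d _ X (rho 0%N @: G) p (2 ^- n 0%N) v) => //.
  move=> _ /imsetP[x xG ->] b; have [Qx [y By xy]] := near x xG.
  have yv : `|y 0 b - v 0 b| <= m.+1%:R * ee 0%N.
    have := flag_ball_proj (U := 0%VS) (P := pred0) b (ltW (eep 0%N)) _ _ By.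
    rewrite !proj_along0; apply => // k _; apply: dmono.
    by rewrite inordK.
  have Sy : `|p (rho 0%N x) 0 b - y 0 b| <= 2 ^- n 0%N.
    by apply/ltW/gcell_dist => //; rewrite rhoP; exact: gfine.
  have -> : p (rho 0%N x) 0 b - v 0 b =
    (p (rho 0%N x) 0 b - y 0 b) + (y 0 b - v 0 b) by ring.
  apply: le_trans (ler_normD _ _) _; apply: le_trans (lerD Sy yv) _.
  have : m.+1%:R * ee 0%N <= d%:R * 2 ^- n 0%N by rewrite ler_pM// ltW.
  have : 2 ^- n 0%N <= d%:R * 2 ^- n 0%N :> R.
    by rewrite ler_peMl ?ler1n// ltW.
  have -> : (3 * d)%:R * 2 ^- n 0%N =
      d%:R * 2 ^- n 0%N + d%:R * 2 ^- n 0%N + d%:R * 2 ^- n 0%N :> R.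
    by rewrite natrM; ring.
  move=> zd med; rewrite -[leLHS]addr0; apply: lerD; first exact: lerD.
  by rewrite mulr_ge0// ltW.
pose ex i : R := (j (inord i))%:R / d%:R.
have ex0 i : 0 <= ex i by rewrite divr_ge0.
have ex1 i : ex i <= 1.
  rewrite ler_pdivrMr ?ltr0n// mul1r ler_nat -[leqRHS]jd.
  by rewrite (bigD1 (inord i))//= leq_addr.
pose bb i := c2 * t (inord i) `^ ex i.
pose D i : R := K%:R * (cn * (2 * c1 * ee i.+1 `^ (- tau))) *
  (ee i.+1 `^ (eps / 2)) `^ (- a i) + 5 ^+ d.
have D0 i : 0 <= D i by rewrite addr_ge0 ?mulr_ge0 ?powR_ge0.
have tree : \sum_(S in rho m @: G) W m S `^ a m <=
    c3 * (\prod_(i < m.+1) bb i) * \prod_(i < m) D i.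
  apply: (sum_powR_tree (e := ex)) => //.
  - by move=> i; rewrite mulr_ge0 ?powR_ge0.
  - move=> i x im; have := Wt (inord i) x; rewrite inordK ?ltnS// => Wi.
    apply: (@le_trans _ _ ((c2 * t (inord i)) `^ ex i)).
      by apply: ge0_ler_powR Wi; rewrite ?nnegrE ?mulr_ge0 ?(ltW (t0 _)).
    rewrite powRM ?(ltW (t0 _))// ler_wpM2r ?powR_ge0//.
    exact: (ler1_powR (cc_ge1 _) (ex1 i)).
  - move=> i P im; pose oi := Ordinal im.
    have [_ _ level] := BadP oi.
    have := level (3 * d)%N
      (proj_along (tnth (V Q theta) (widen_ord (leqnSn m) oi)) v) P
      [set S in rho i.+1 @: G | rho i S == P]%SET.
    rewrite (eq_bigl (fun S => (S \in rho i.+1 @: G) && (rho i S == P))); last first.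
      by move=> S; rewrite inE.
    apply.
      apply/fintype.subsetP => S; rewrite inE => /andP[/imsetP[x xG ->] _].
      rewrite finset.in_setD imset_f ?inE// andbT.
      move: xG; rewrite inE => /andP[+ _]; apply: contra => xB.
      by apply/existsP; exists oi.
    move=> S; rewrite inE => /andP[SG /eqP SP]; split => // b.
    by rewrite -SP; exact: (Gnear oi).
apply: le_trans nuG _; rewrite lee_fin.
have -> : \sum_(x in G) w x = \sum_(S in rho m @: G) W m S `^ a m.
  rewrite (eq_imset _ rhom) imset_id; apply: eq_bigr => x _.
  rewrite a_m powRr1// /W (big_pred1 x)// => y /=.
  by rewrite rhom.
apply: le_trans tree _.
have -> : \prod_(i < m.+1) bb i =
    c2 ^+ m.+1 * \prod_(i < m.+1) t i `^ ((j i)%:R / d%:R).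
  rewrite big_split/= prodr_const card_ord; congr (_ * _).
  by apply: eq_bigr => i _; rewrite /ex inord_val.
set T := \prod_(i < m.+1) _.
have T0 : 0 <= T by apply: prodr_ge0 => i _; exact: powR_ge0.
have -> : delta `^ (- ((tau + eps) * \sum_(i < m) r (lift ord0 i))) =
    \prod_(i < m) ee i.+1 `^ (- (tau + eps)).
  rewrite -mulNr mulrC powRrM.
  have -> : delta `^ (\sum_(i < m) r (lift ord0 i)) = \prod_(i < m) ee i.+1.
    rewrite (big_morph (powR delta) (id1 := 1) (op1 := *%R)).
    - by apply: eq_bigr => i _; rewrite eeS.
    - by move=> x y; rewrite powRD// (gt_eqF de0) implybT.
    - exact: powRr0.
  by apply: powR_prod => i; exact: ltW.
have DZ : \prod_(i < m) (D i * Z) <= \prod_(i < m) ee i.+1 `^ (- (tau + eps)).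
  apply: ler_prod => i _; apply/andP; split; first exact: mulr_ge0.
  have -> : D i = A * ee i.+1 `^ (- tau) * (ee i.+1 `^ (eps / 2)) `^ (- a i) + 5 ^+ d.
    by rewrite /D /A !mulrA.
  have lamC : (A + 5 ^+ d) * Z * ee i.+1 `^ (eps / 2) <= 1.
    apply: le_trans (ler_wpM2r (ltW (lam0 i)) C1C) _.
    by apply: le_trans absorb1; exact: (ler_wpM2l C0 (lam1 i)).
  have ai01 : 0 <= a i <= 1 by rewrite (ltW (a_gt0 i)) a_le.
  exact: (level_constant_le (ee01 i.+1) ai01 eps0 tau0 A0 pow5 Z0 lamC).
apply: le_trans (ler_wpM2r T0 DZ).
rewrite big_split/= prodr_const card_ord.
have Dp0 : 0 <= \prod_(i < m) D i by exact: prodr_ge0.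
suff cZ : c3 * c2 ^+ m.+1 <= Z ^+ m.
  have -> : c3 * (c2 ^+ m.+1 * T) * \prod_(i < m) D i =
    c3 * c2 ^+ m.+1 * (T * \prod_(i < m) D i) by ring.
  have -> : \prod_(i < m) D i * Z ^+ m * T = Z ^+ m * (T * \prod_(i < m) D i) by ring.
  by rewrite ler_wpM2r// mulr_ge0.
have c21 : 1 <= c2 := cc_ge1 _; have c31 : 1 <= c3 := cc_ge1 _.
have Z1 : 1 <= Z by rewrite -[1]mulr1 ler_pM// -[1]mulr1 ler_pM.
have c2Z : c2 <= Z by rewrite /Z -mulrA ler_peMr// -[1]mulr1 ler_pM.
have -> : m = m.-1.+1 by rewrite prednK.
have -> : c3 * c2 ^+ m.-1.+2 = Z * c2 ^+ m.-1 by rewrite !exprS /Z; ring.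
by rewrite exprS ler_wpM2l// lerXn2r ?nnegrE.
Qed.
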